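(* Let $c\geq 3$ and let $\Phi:\mathscr{C}(\mathbb{E}^{c})\to\mathscr{C}(\mathbb{E}^{c+1})$ be a mapping. Then $\Phi$ is a non-trivial lattice homomorphism if and only if there exist $C,D\in\mathscr{C}(\mathbb{E}^{c})$ with $\Phi(C)\neq\Phi(D)$ and, for all $C\in\mathscr{C}(\mathbb{E}^{c})$ and all $x,x_{1},\dots,x_{n}\in\mathbb{E}^{c}$, the following conditions hold: (i) $x\in C\Rightarrow\Phi(\{x\})\subseteq\Phi(C)$; (ii) $x\notin C\Rightarrow\Phi(\{x\})\cap\Phi(C)=\Phi(\emptyset)$; (iii) $\bigcup_{x\in\mathbb{E}^{c}}\Phi(\{x\})$ is convex; (iv) $C\subseteq\operatorname{conv}\{x_{1},\dots,x_{n}\}\Rightarrow\Phi(C)\subseteq\operatorname{conv}(\Phi(\{x_{1}\})\cup\dots\cup\Phi(\{x_{n}\}))$.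
   Context: $\mathbb{E}^{d}$ denotes $d$-dimensional Euclidean space. $\mathscr{C}(\mathbb{E}^{d})$ is the set of all compact convex subsets of $\mathbb{E}^{d}$, including the empty set; it is a lattice with $C\wedge D=C\cap D$ and $C\vee D=\operatorname{conv}(C\cup D)$. A lattice homomorphism preserves both operations $\wedge$ and $\vee$. It is trivial if it maps all elements (including $\emptyset$) to one and the same set, and non-trivial otherwise. *)

(* Defs.v *)
From HB Require Import structures.
From mathcomp Require Import all_boot all_order all_algebra.
From mathcomp Require Import all_classical all_reals all_analysis.
From mathcomp Require Import ring lra.

Set Implicit Arguments.
Unset Strict Implicit.
Unset Printing Implicit Defensive.

Import Order.TTheory GRing.Theory Num.Theory.
Import numFieldNormedType.Exports.

Local Open Scope classical_set_scope.
Local Open Scope ring_scope.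

Definition convex_hull (R : numDomainType) (M : lmodType R) (A : set M) : set M :=
  smallest (@convex_set R M) A.

Section Convex.
Context {R : realType} {M : lmodType R}.
Implicit Types A B : set M.

Lemma convex_setP A : @convex_set R M A <->
  forall x y (t : R), A x -> A y -> 0 <= t -> t <= 1 ->
    A (t *: x + (1 - t) *: y).
Proof.
split=> [cA x y t Ax Ay t0 t1|cA x y t].
  have tP : Itv.spec (@Itv.num_sem R) (Itv.Real `[0%Z, 1%Z]) t.
    by rewrite /= /Itv.num_sem /= realE t0 in_itv /= t0 t1.
  have := cA x y (Itv.mk tP).
  by rewrite !inE; apply.
by rewrite !inE => Ax Ay; apply: cA.
Qed.

Lemma convex_set_hull A : @convex_set R M (convex_hull A).
Proof.
apply/convex_setP => x y t hx hy t0 t1 B [cB AB].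
by move/convex_setP: (cB); apply => //; [apply: hx|apply: hy].
Qed.

Lemma convex_setI A B :
  @convex_set R M A -> @convex_set R M B -> @convex_set R M (A `&` B).
Proof.
move=> /convex_setP cA /convex_setP cB; apply/convex_setP.
by move=> x y t [Ax Bx] [Ay By] t0 t1; split; [apply: cA|apply: cB].
Qed.

Lemma convex_set_set0 : @convex_set R M set0.
Proof. exact/convex_setP. Qed.

Lemma convex_set_set1 (x : M) : @convex_set R M [set x].
Proof.
apply/convex_setP => _ _ t -> -> _ _ /=.
by rewrite -scalerDl addrC subrK scale1r.
Qed.

Lemma convex_set_weights A (x y : M) (a b : R) : @convex_set R M A ->
  A x -> A y -> 0 <= a -> 0 <= b ->
  exists2 z, A z & a *: x + b *: y = (a + b) *: z.
Proof.
move=> /convex_setP cA Ax Ay a0 b0.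
have [ab0|abN0] := eqVneq (a + b) 0.
  have aE : a = 0 by lra.
  have bE : b = 0 by lra.
  by exists x => //; rewrite aE bE addr0 !scale0r addr0.
have ab_gt0 : 0 < a + b by rewrite lt_def abN0 addr_ge0.
exists ((a / (a + b)) *: x + (1 - a / (a + b)) *: y).
  apply: cA => //; first by rewrite divr_ge0// ltW.
  by rewrite ler_pdivrMr// mul1r lerDl.
rewrite scalerDr !scalerA; congr (_ *: _ + _ *: _); by field.
Qed.

End Convex.

Arguments convex_set_hull {R M} A.
Arguments convex_set_set0 {R M}.
Arguments convex_set_set1 {R M} x.
Arguments convex_setI {R M A B}.

Section CompactHull.
Context {R : realType} {d : nat}.
Implicit Types A B : set 'rV[R]_d.

Let mix (p : R * ('rV[R]_d * 'rV[R]_d)) : 'rV[R]_d :=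
  p.1 *: p.2.1 + (1 - p.1) *: p.2.2.

Let mix_continuous : continuous mix.
Proof.
move=> p; apply: cvgD; apply: cvgZ => /=.
- exact: cvg_fst.
- by apply: (cvg_comp snd fst); [exact: cvg_snd|exact: cvg_fst].
- by apply: cvgB; [exact: cvg_cst|exact: cvg_fst].
- by apply: (cvg_comp snd snd); exact: cvg_snd.
Qed.

Let convex_hullU_mix A B (a b : 'rV[R]_d) : A a -> B b ->
  convex_set A -> convex_set B ->
  convex_hull (A `|` B) = mix @` (`[0, 1]%classic `*` (A `*` B)).
Proof.
move=> Aa Bb cA cB; apply/seteqP; split.
  apply: smallest_sub.
    apply/convex_setP => _ _ l [[t [x y]] [/= + [Ax By]] <-]
      [[s [x' y']] [/= + [Ax' By']] <-] l0 l1.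
    rewrite !in_itv /= => /andP[t0 t1] /andP[s0 s1].
    have h1 : 0 <= l * t by rewrite mulr_ge0.
    have h2 : 0 <= (1 - l) * s by rewrite mulr_ge0// subr_ge0.
    have h3 : 0 <= l * (1 - t) by rewrite mulr_ge0// subr_ge0.
    have h4 : 0 <= (1 - l) * (1 - s) by rewrite mulr_ge0// subr_ge0.
    have [x2 Ax2 xE] := convex_set_weights cA Ax Ax' h1 h2.
    have [y2 By2 yE] := convex_set_weights cB By By' h3 h4.
    exists (l * t + (1 - l) * s, (x2, y2)).
      split => //=; rewrite in_itv /= addr_ge0//=.
      by have : l * t + (1 - l) * s + (l * (1 - t) + (1 - l) * (1 - s)) = 1;
        [ring|lra].
    rewrite /mix /= -xE.
    have -> : 1 - (l * t + (1 - l) * s) = l * (1 - t) + (1 - l) * (1 - s).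
      by ring.
    by rewrite -yE !scalerDr !scalerA addrACA.
  move=> x [Ax|Bx].
    exists (1, (x, b)); last by rewrite /mix /= subrr scale1r scale0r addr0.
    by split => //=; rewrite in_itv /= ler01 lexx.
  exists (0, (a, x)); last by rewrite /mix /= subr0 scale1r scale0r add0r.
  by split => //=; rewrite in_itv /= ler01 lexx.
move=> _ [[t [x y]] [/= + [Ax By]] <-]; rewrite in_itv /= => /andP[t0 t1].
have /convex_setP := convex_set_hull (A `|` B).
by apply => //; apply: sub_gen_smallest; [left|right].
Qed.

Lemma compact_convex_hullU A B : compact A -> compact B ->
  convex_set A -> convex_set B -> compact (convex_hull (A `|` B)).
Proof.
move=> kA kB cA cB.
have [->|/set0P[a Aa]] := eqVneq A set0.
  by rewrite set0U /convex_hull smallest_id.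
have [->|/set0P[b Bb]] := eqVneq B set0.
  by rewrite setU0 /convex_hull smallest_id.
rewrite (convex_hullU_mix Aa Bb cA cB).
apply: continuous_compact.
  by apply: continuous_subspaceT; exact: mix_continuous.
apply: compact_setX; last exact: compact_setX.
exact: segment_compact.
Qed.

End CompactHull.

Arguments compact_convex_hullU {R d A B}.

(* The norm topology on row vectors comes from the sup norm; it is the usual
   topology of d-dimensional Euclidean space, so compactness is the usual one. *)
Record ccset (R : realType) (d : nat) := CCSet {
  ccset_val :> set 'rV[R]_d;
  ccset_prop : `[< compact ccset_val /\ convex_set ccset_val >] }.

HB.instance Definition _ R d := [isSub for @ccset_val R d].
HB.instance Definition _ R d := [Choice of ccset R d by <:].

Section CCSetLattice.
Context {R : realType} {d : nat}.
Implicit Types A B C : ccset R d.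

Lemma ccset_compact A : compact A.
Proof. by have /asboolP[] := ccset_prop A. Qed.

Lemma ccset_convex A : convex_set A.
Proof. by have /asboolP[] := ccset_prop A. Qed.

Arguments ccset_compact : clear implicits.
Arguments ccset_convex : clear implicits.

Definition mk_ccset (A : set 'rV[R]_d) (kA : compact A) (cA : convex_set A) :
  ccset R d := CCSet (asboolT (conj kA cA)).

Definition ccset0 : ccset R d := mk_ccset compact0 convex_set_set0.

Definition ccset1 (x : 'rV[R]_d) : ccset R d :=
  mk_ccset (@compact_set1 _ x) (convex_set_set1 x).

Lemma ccsetI_compact A B : compact (A `&` B).
Proof.
apply: compact_closedI; first exact: ccset_compact.
by apply: compact_closed; [exact: norm_hausdorff|exact: ccset_compact].
Qed.

Definition ccsetI A B : ccset R d :=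
  mk_ccset (@ccsetI_compact A B) (convex_setI (ccset_convex A) (ccset_convex B)).

Definition ccsetU A B : ccset R d :=
  mk_ccset
    (compact_convex_hullU (ccset_compact A) (ccset_compact B)
       (ccset_convex A) (ccset_convex B))
    (convex_set_hull (A `|` B)).

Definition ccset_le A B : bool := `[< A `<=` B >].

Fact ccset_le_refl : reflexive ccset_le.
Proof. by move=> A; apply/asboolP. Qed.

Fact ccset_le_anti : antisymmetric ccset_le.
Proof.
move=> A B /andP[/asboolP AB /asboolP BA].
by apply: val_inj; apply/seteqP; split.
Qed.

Fact ccset_le_trans : transitive ccset_le.
Proof.
by move=> B A C /asboolP AB /asboolP BC; apply/asboolP; exact: subset_trans BC.
Qed.

Fact ccset_leI A B C : ccset_le A (ccsetI B C) = ccset_le A B && ccset_le A C.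
Proof.
apply/asboolP/andP => [|[/asboolP AB /asboolP AC]]; last by rewrite subsetI.
by rewrite subsetI => -[AB AC]; split; apply/asboolP.
Qed.

Fact ccset_leU A B C : ccset_le (ccsetU A B) C = ccset_le A C && ccset_le B C.
Proof.
apply/asboolP/andP => [ABC|[/asboolP AC /asboolP BC]].
  by split; apply/asboolP => x hx; apply: ABC; apply: sub_gen_smallest;
    [left|right].
by apply: smallest_sub; [exact: ccset_convex|rewrite subUset].
Qed.

End CCSetLattice.

Fact ccset_display : Order.disp_t. Proof. exact: Order.Disp tt tt. Qed.

HB.instance Definition _ R d := @Order.Le_isPOrder.Build ccset_display
  (ccset R d) ccset_le ccset_le_refl ccset_le_anti ccset_le_trans.

HB.instance Definition _ R d := @Order.POrder_MeetJoin_isLattice.Build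
  ccset_display (ccset R d) ccsetI ccsetU ccset_leI ccset_leU.

Lemma ccset_meetE R d (A B : ccset R d) :
  Order.meet A B = A `&` B :> set 'rV[R]_d.
Proof. by []. Qed.

Lemma ccset_joinE R d (A B : ccset R d) :
  Order.join A B = convex_hull (A `|` B) :> set 'rV[R]_d.
Proof. by []. Qed.

Definition lattice_hom d (L : latticeType d) d' (L' : latticeType d')
    (f : L -> L') : Prop :=
  Order.meet_morphism f /\ Order.join_morphism f.

Definition trivial_map (T U : Type) (f : T -> U) : Prop :=
  exists E : U, forall C : T, f C = E.

(* Main.v *)
(* Only the convexity of the union of the sets P x = Phi {x} is deep. Let F be the
   image of the empty set, so that P x and P y meet in F for x <> y. A set in
   Euclidean space contains at most countably many disjoint sets with nonempty
   interior; applied to pencils of simplices through a common face, this bounds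
   the dimension of images: each P x lies on a line, and the image of a segment
   lies in a plane. Hence three cases:
   - F is a point o and each P x is a segment from o to a point t x;
   - F is empty and each P x is a single point t x;
   - F is empty, and the P x lie on lines through a common (possibly infinite)
     point, with top points t x and bottom points b x.
   If z lies between x and y, then t z is on or below the segment [t x, t y]. It
   cannot be strictly below for two lines through z, because the images of two
   crossing segments meet exactly in P z. This already makes t z lie on
   [t x, t y] for all lines. So t maps segments into segments; it maps them onto
   segments, since a jump of t at one point would propagate to all points of a
   parallel line, while monotone functions have countably many jumps. *)

Require Import Defs.
From mathcomp Require Import all_boot all_order all_algebra.
From mathcomp Require Import all_classical all_reals all_analysis.
From mathcomp Require Import ring lra zify.

Set Implicit Arguments.
Unset Strict Implicit.
Unset Printing Implicit Defensive.

Import Order.TTheory GRing.Theory Num.Theory.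
Import numFieldNormedType.Exports.

Local Open Scope classical_set_scope.
Local Open Scope ring_scope.

(** * Points on a line by parameter, and affine independence *)

Section AffineIndependence.
Context {R : realType}.

(** Images are studied in homogeneous coordinates [hvec p = (1, p)]. Convex combinations become
    nonnegative combinations of arbitrary scale, and the upward direction becomes a single vector
    [o]: minus the vector of the common endpoint in the cone case, otherwise a representative of the
    common point of the lines, which is at infinity when its first coordinate vanishes. Hence one
    relation, [T z = a T x + b T y - d o] with nonnegative [d], covers concurrent and parallel
    lines, and also the bottoms when [o] is replaced by [- o]. The rank estimates work from both
    sides. Since the target has one dimension more than the source, a set whose affine span has
    codimension at least two gains at most one dimension under [Phi]; this is needed for segments,
    whence [3 <= c]. Conversely the image of a triangle has rank at least two more than the image of
    a vertex, so three tops together with [o] are linearly independent and coefficients can be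
    compared. This comparison drives the rigidity argument. *)

Definition seg_pt n (x y : 'rV[R]_n) (s : R) : 'rV[R]_n := (1 - s) *: x + s *: y.

Lemma seg_pt0 n (x y : 'rV[R]_n) : seg_pt x y 0 = x.
Proof. by rewrite /seg_pt subr0 scale1r scale0r addr0. Qed.

Lemma seg_pt1 n (x y : 'rV[R]_n) : seg_pt x y 1 = y.
Proof. by rewrite /seg_pt subrr scale1r scale0r add0r. Qed.

Lemma seg_ptC n (x y : 'rV[R]_n) s : seg_pt x y s = seg_pt y x (1 - s).
Proof. by apply/rowP => i; rewrite !mxE; ring. Qed.

Definition affine_indep n (x y a : 'rV[R]_n) : Prop :=
  forall r s t : R, r + s + t = 0 -> r *: x + s *: y + t *: a = 0 ->
    [/\ r = 0, s = 0 & t = 0].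

Definition linear_indep4 n (u v w o : 'rV[R]_n) : Prop :=
  forall r s t q : R, r *: u + s *: v + t *: w + q *: o = 0 ->
    [/\ r = 0, s = 0, t = 0 & q = 0].

Lemma seg_pt_neq n (x y : 'rV[R]_n) s t : x != y -> s != t ->
  seg_pt x y s != seg_pt x y t.
Proof.
move=> xy st; apply: contraNneq xy => /rowP h; apply/eqP/rowP => i.
have := h i; rewrite !mxE => hi.
have : (s - t) * (x 0 i - y 0 i) = 0 by rewrite -(subrr (s * y 0 i)); lra.
by move/eqP; rewrite mulf_eq0 subr_eq0 (negPf st) /= subr_eq0 => /eqP.
Qed.

Lemma affine_indep_neq n (x y a : 'rV[R]_n) : affine_indep x y a -> x != y.
Proof.
move=> h; apply/eqP => xy; have [] := h 1 (-1) 0.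
- by rewrite addr0 subrr.
- by rewrite xy scale0r addr0 scale1r scaleN1r subrr.
- by move=> /eqP; rewrite oner_eq0.
Qed.

Lemma affine_indepC n (x y a : 'rV[R]_n) :
  affine_indep x y a -> affine_indep y x a.
Proof.
move=> h r s t rst e; have [] // := h s r t.
- by rewrite (addrC s).
- by rewrite (addrC (s *: x)).
Qed.

Lemma affine_indepA n (x y a : 'rV[R]_n) :
  affine_indep x y a -> affine_indep y a x.
Proof.
move=> h r s t rst e; have [||-> -> ->] := h t r s; last by split.
- by rewrite -rst; ring.
- by rewrite -e -addrA addrC.
Qed.

Lemma affine_indep_seg n (x y a : 'rV[R]_n) s t : s != t ->
  affine_indep x y a -> affine_indep (seg_pt x y s) (seg_pt x y t) a.
Proof.
move=> st h p q r pqr e.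
have [||h1 h2 h3] := h (p * (1 - s) + q * (1 - t)) (p * s + q * t) r.
- by rewrite -pqr; ring.
- by rewrite -e; apply/rowP => i; rewrite !mxE; ring.
have : p * (s - t) = 0.
  transitivity (p * s + q * t - (p + q + r) * t + r * t); first by ring.
  by rewrite h2 h3 -{2}h3 pqr; ring.
move/eqP; rewrite mulf_eq0 subr_eq0 (negPf st) orbF => /eqP p0.
by split => //; move: pqr; rewrite p0 h3; lra.
Qed.

Lemma linear_indep4_inj n (u v w o : 'rV[R]_n) a b d a' b' d' :
  linear_indep4 u v w o ->
  a *: u + b *: v - d *: o = a' *: u + b' *: v - d' *: o ->
  [/\ a = a', b = b' & d = d'].
Proof.
move=> h e; have [|+ + _ +] := h (a - a') (b - b') 0 (d' - d).
  move/eqP: e; rewrite -subr_eq0 => /eqP <-.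
  by apply/rowP => i; rewrite !mxE; ring.
by do 3! [move/eqP; rewrite subr_eq0 => /eqP->].
Qed.

End AffineIndependence.

(** * Rigidity of concave families of tops *)

Section Tightness.
Context {R : realType} {n m : nat}.
Variables (T : 'rV[R]_n -> 'rV[R]_m) (o : 'rV[R]_m).

Hypothesis off_line : forall x y : 'rV[R]_n, x != y ->
  exists a, affine_indep x y a.

Hypothesis indepT : forall x y a : 'rV[R]_n, affine_indep x y a ->
  linear_indep4 (T x) (T y) (T a) o.

Hypothesis convexT : forall (x y : 'rV[R]_n) s, x != y -> 0 < s -> s < 1 ->
  exists a b d, [/\ 0 < a, 0 < b, 0 <= d &
    T (seg_pt x y s) = a *: T x + b *: T y - d *: o].

(* [T z] is the top point of the image of [z]; [slack] says that the chord from
   [T x] to [T y] passes strictly above it, in the direction [o]. *)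
Definition slack (x z y : 'rV[R]_n) :=
  exists a b d, [/\ 0 < a, 0 < b, 0 < d & T z = a *: T x + b *: T y - d *: o].

Hypothesis crossT : forall (x y x' y' : 'rV[R]_n) s s',
  0 < s -> s < 1 -> 0 < s' -> s' < 1 ->
  seg_pt x y s = seg_pt x' y' s' -> affine_indep x y x' ->
  slack x (seg_pt x y s) y -> slack x' (seg_pt x y s) y' -> False.

Let slackC x z y : slack x z y -> slack y z x.
Proof.
by move=> [a [b [d [? ? ? e]]]]; exists b, a, d; split=> //; rewrite (addrC (b *: _)).
Qed.

Let convexL x y r s t : x != y -> s < r -> r < t ->
  exists a b d, [/\ 0 < a, 0 < b, 0 <= d & T (seg_pt x y r) =
    a *: T (seg_pt x y s) + b *: T (seg_pt x y t) - d *: o].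
Proof.
move=> xy sr rt.
have st : 0 < t - s by lra.
have -> : seg_pt x y r = seg_pt (seg_pt x y s) (seg_pt x y t) ((r - s) / (t - s)).
  by apply/rowP => i; rewrite !mxE; field; rewrite gt_eqF.
apply: convexT.
- by apply: seg_pt_neq => //; rewrite lt_eqF//; lra.
- by rewrite divr_gt0// subr_gt0.
- by rewrite ltr_pdivrMr// mul1r; lra.
Qed.

Let slack_left x y s r t r' : x != y -> s < r' -> r' < r -> r < t ->
  slack (seg_pt x y s) (seg_pt x y r) (seg_pt x y t) ->
  slack (seg_pt x y s) (seg_pt x y r') (seg_pt x y t).
Proof.
move=> xy sr' r'r rt [a [b [d [a0 b0 d0 e]]]].
have [a' [b' [d' [a'0 b'0 d'0 e']]]] := convexL xy sr' r'r.
exists (a' + b' * a), (b' * b), (b' * d + d'); split.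
- by rewrite addr_gt0// mulr_gt0.
- by rewrite mulr_gt0.
- by rewrite ltr_wpDr// mulr_gt0.
- by rewrite e' e; apply/rowP => i; rewrite !mxE; ring.
Qed.

(** Writing [T] at [s] over [s'] and [r], and solving for [T] at [r], requires dividing by
    [1 - a * b']. Uniqueness of coefficients against the direct expression over [s'] and [t] shows
    that this factor is positive. *)
Let slack_widen x y s r t s' : x != y -> s' < s -> s < r -> r < t ->
  slack (seg_pt x y s) (seg_pt x y r) (seg_pt x y t) ->
  slack (seg_pt x y s') (seg_pt x y r) (seg_pt x y t).
Proof.
move=> xy s's sr rt [a [b [d [a0 b0 d0 e]]]].
have [a' [b' [d' [a'0 b'0 d'0 e']]]] := convexL xy s's sr.
have [a2 [b2 [d2 [a20 b20 d20 e2]]]] := convexL xy (lt_trans s's sr) rt.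
have [c cP] := off_line xy.
have st : s' != t by rewrite lt_eqF//; lra.
have [|_ h2 h3] := linear_indep4_inj (a := (1 - a * b') * a2)
   (b := (1 - a * b') * b2) (d := (1 - a * b') * d2)
   (a' := a * a') (b' := b) (d' := d + a * d')
   (indepT (affine_indep_seg st cP)).
  transitivity ((1 - a * b') *: T (seg_pt x y r)).
    by rewrite e2; apply/rowP => i; rewrite !mxE; ring.
  have := e; rewrite e' => /rowP e3; apply/rowP => i.
  by have := e3 i; rewrite !mxE => e3i; rewrite mulrBl mul1r {1}e3i; ring.
have k0 : 0 < 1 - a * b' by rewrite -(pmulr_lgt0 _ b20) h2.
exists a2, b2, d2; split => //.
by rewrite -(pmulr_rgt0 _ k0) h3 ltr_pwDl// mulr_ge0// ltW.
Qed.

(* Once the inequality is strict somewhere on a line, it is strict at every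
   point of that line for a wide enough chord. *)
Let slack_spread x y s u : x != y -> 0 < s -> s < 1 ->
  slack x (seg_pt x y s) y -> exists p q, [/\ p < u, u < q &
    slack (seg_pt x y p) (seg_pt x y u) (seg_pt x y q)].
Proof.
move=> xy s0 s1.
rewrite -[X in slack X](seg_pt0 x y) -[X in slack _ _ X](seg_pt1 x y) => h.
have yx : y != x by rewrite eq_sym.
pose p := Num.min 0 u - 1; pose q := Num.max 1 u + 1.
have p0 : p < 0 by rewrite /p; have : Num.min 0 u <= 0; [rewrite ge_min lexx|lra].
have pu : p < u by rewrite /p; have : Num.min 0 u <= u; [rewrite ge_min lexx orbT|lra].
have q1 : 1 < q by rewrite /q; have : 1 <= Num.max 1 u; [rewrite le_max lexx|lra].
have qu : u < q by rewrite /q; have : u <= Num.max 1 u; [rewrite le_max lexx orbT|lra].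
have h1 := slack_widen xy p0 s0 s1 h.
have h2 : slack (seg_pt x y p) (seg_pt x y s) (seg_pt x y q).
  apply: slackC; rewrite !(seg_ptC x).
  apply: (slack_widen yx (s := 1 - 1)); [lra..|].
  by rewrite -!seg_ptC; exact: slackC.
exists p, q; split => //.
have [us|su|->//] := ltgtP u s; first by apply: (slack_left xy pu us _ h2); lra.
apply: slackC; rewrite !(seg_ptC x).
apply: (slack_left yx (r := 1 - s)); [lra..|].
by rewrite -!seg_ptC; exact: slackC.
Qed.

(** The lines may meet outside both chords, where [crossT] says nothing; [slack_spread] moves both
    slacknesses to the meeting point. *)
Let crossL x y k l u v s t : affine_indep x y k ->
  l != k -> seg_pt x y u = seg_pt k l v -> 0 < s -> s < 1 -> 0 < t -> t < 1 ->
  slack x (seg_pt x y s) y -> slack k (seg_pt k l t) l -> False.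
Proof.
move=> ik lk e s0 s1 t0 t1 h1 h2.
have xy := affine_indep_neq ik.
have [p [q [pu uq {}h1]]] := slack_spread u xy s0 s1 h1.
have kl : k != l by rewrite eq_sym.
have [p' [q' [pu' uq' {}h2]]] := slack_spread v kl t0 t1 h2.
have E x' y' (a b c : R) : a < b -> b < c -> exists2 r, 0 < r < 1 &
   seg_pt x' y' b = seg_pt (seg_pt x' y' a) (seg_pt x' y' c : 'rV[R]_n) r.
  move=> ab bc; have ac : 0 < c - a by lra.
  exists ((b - a) / (c - a)).
    apply/andP; split; first by rewrite divr_gt0// subr_gt0.
    by rewrite ltr_pdivrMr// mul1r; lra.
  by apply/rowP => i; rewrite !mxE; field; rewrite gt_eqF.
have [r /andP[r0 r1] er] := E x y _ _ _ pu uq.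
have [r' /andP[r'0 r'1] er'] := E k l _ _ _ pu' uq'.
apply: (@crossT (seg_pt x y p) (seg_pt x y q) (seg_pt k l p') (seg_pt k l q')
  r r') => //.
- by rewrite -er -er'.
- apply: affine_indep_seg; first by rewrite lt_eqF//; lra.
  (* k + p'(l - k) lies off the line through x and y *)
  move=> a b c abc eabc.
  have v0 : v != 0.
    apply/eqP => v0; move: e; rewrite v0 => e.
    have [] := ik (1 - u) u (-1); first by ring.
      rewrite -/(seg_pt x y u) e; apply/rowP => i; rewrite !mxE; ring.
    by move=> _ _ /eqP; rewrite oppr_eq0 oner_eq0.
  have vl i : v * l 0 i = (1 - u) * x 0 i + u * y 0 i - (1 - v) * k 0 i.
    by have /rowP/(_ i) := e; rewrite !mxE => ->; ring.
  have [||a1 b1 c1] := ik (v * a + c * p' * (1 - u)) (v * b + c * p' * u)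
     (c * (v * (1 - p') - p' * (1 - v))).
  + by have -> : c = - a - b; [lra|ring].
  + apply/rowP => i; have /rowP/(_ i) := eabc; rewrite !mxE => ei.
    transitivity (v * (a * x 0 i + b * y 0 i + c * (1 - p') * k 0 i) +
       c * p' * (v * l 0 i)); first by rewrite vl; ring.
    by rewrite -[RHS](mulr0 v) -ei; ring.
  have c0 : c = 0.
    move/eqP: c1; rewrite mulf_eq0 => /orP[/eqP //|/eqP c1].
    by have : v = p'; lra.
  move: a1 b1; rewrite c0 !mul0r !addr0 => /eqP + /eqP.
  by rewrite !mulf_eq0 (negPf v0) /= => /eqP-> /eqP->.
- by rewrite -er.
- by rewrite -er e.
Qed.

(* If [z] is slack on the line [x y], then every other line meeting that line is
   tight; the lines [x c], [y c] and a line through [z] meeting both of them then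
   put [T z] in the span of [T x], [T y] and [T c]. *)
Lemma tight x y s : x != y -> 0 < s -> s < 1 ->
  exists a b, [/\ 0 < a, 0 < b & T (seg_pt x y s) = a *: T x + b *: T y].
Proof.
move=> xy s0 s1; have [a [b [d [a0 b0]]]] := convexT xy s0 s1.
rewrite le_eqVlt => /orP[/eqP<- ->|d0 e].
  by exists a, b; rewrite scale0r subr0.
exfalso; have sl : slack x (seg_pt x y s) y by exists a, b, d.
have [c xyc] := off_line xy.
have T0 k l r v u : affine_indep x y k -> l != k -> 0 < r -> r < 1 ->
    seg_pt x y u = seg_pt k l v ->
    exists p q, [/\ 0 < p, 0 < q & T (seg_pt k l r) = p *: T k + q *: T l].
  move=> xyk lk r0 r1 ek.
  have kl : k != l by rewrite eq_sym.
  have [p [q [d' [p0 q0]]]] := convexT kl r0 r1.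
  rewrite le_eqVlt => /orP[/eqP<- ->|d'0 e'].
    by exists p, q; rewrite scale0r subr0.
  by exfalso; apply: (crossL xyk lk ek s0 s1 r0 r1 sl); exists p, q, d'.
(* [k] lies beyond [x] on the line from [c], so that [T x] involves [T k] with a positive
   coefficient. The factors [- s] and [(1 - s) / 2] make the [c] terms cancel at parameter
   [2 * s / (1 + s)] of [k l], which is therefore the given point of [x y]. *)
pose k := seg_pt x c (- s); pose l := seg_pt y c ((1 - s) / 2).
have xcy := affine_indepC (affine_indepA (affine_indepA xyc)).
have cy : y != c := affine_indep_neq (affine_indepA xyc).
have xyk : affine_indep x y k.
  have h : affine_indep (seg_pt x c 0) k y.
    by apply: affine_indep_seg => //; rewrite gt_eqF//; lra.
  by rewrite seg_pt0 in h; apply: affine_indepC (affine_indepA (affine_indepA h)).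
have ck : c != k.
  rewrite -(seg_pt1 x c); apply: seg_pt_neq; first exact: affine_indep_neq xcy.
  by rewrite gt_eqF//; lra.
have lk : l != k.
  apply/eqP => /rowP lk; have [||] := xyc (- (1 + s)) ((1 + s) / 2) ((1 + s) / 2).
  - by field.
  - by apply/rowP => i; have := lk i; rewrite !mxE; lra.
  - by lra.
have s10 : 0 < 1 + s by lra.
have [p [q [p0 q0 ex]]] : exists p q, [/\ 0 < p, 0 < q & T x = p *: T k + q *: T c].
  have {1}-> : x = seg_pt k c (s / (1 + s)).
    by apply/rowP => i; rewrite !mxE; field; rewrite gt_eqF.
  apply: (T0 k c _ (s / (1 + s)) 0) => //.
  - by rewrite divr_gt0.
  - by rewrite ltr_pdivrMr// mul1r; lra.
  - by apply/rowP => i; rewrite !mxE; field; rewrite gt_eqF.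
have [p' [q' [p'0 q'0 el]]] : exists p q, [/\ 0 < p, 0 < q & T l = p *: T c + q *: T y].
  rewrite /l seg_ptC; apply: (T0 c y _ 1 1) => //; [lra|lra|].
  by rewrite !seg_pt1.
have [p2 [q2 [p20 q20 ez]]] : exists p q,
    [/\ 0 < p, 0 < q & T (seg_pt x y s) = p *: T k + q *: T l].
  have -> : seg_pt x y s = seg_pt k l (2 * s / (1 + s)).
    by apply/rowP => i; rewrite !mxE; field; rewrite gt_eqF.
  apply: (T0 k l _ (2 * s / (1 + s)) s) => //.
  - by rewrite divr_gt0// mulr_gt0.
  - by rewrite ltr_pdivrMr// mul1r; lra.
  - by apply/rowP => i; rewrite !mxE; field; rewrite gt_eqF.
(* Eliminating [T k] and [T l] from the tight relations and comparing with the slack one leaves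
   [p * d] as the coefficient of [o]. *)
have [|_ _ _ /eqP] := indepT xyc (r := p2 - p * a) (s := p * (q2 * q' - b))
    (t := p * q2 * p' - p2 * q) (q := p * d).
  apply/rowP => i; move: e ez ex el => /rowP/(_ i) + /rowP/(_ i) + /rowP/(_ i) +
    /rowP/(_ i).
  rewrite !mxE => -> ez ex el.
  have h1 := congr1 ( *%R p) ez; have h2 := congr1 ( *%R p2) ex.
  by rewrite el in h1; lra.
by rewrite mulf_eq0 !gt_eqF.
Qed.

End Tightness.

Lemma uncountable_unit_itv (R : realType) : ~ countable (`]0, 1]%classic : set R).
Proof.
move=> /countable_lebesgue_measure0; rewrite lebesgue_measure_itv /= lte_fin ltr01.
by rewrite -EFinB subr0 => /eqP; rewrite eqe oner_eq0.
Qed.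

Lemma countable_rat_inj (R : realType) (A : set R) (I : countType) (f : R -> I) :
  {in A &, injective f} -> countable A.
Proof.
move=> finj; apply/countable_injP; exists (pickle \o f) =>
  x y Ax Ay /= /(pcan_inj pickleK).
exact: finj.
Qed.

(** * Betweenness-preserving maps have no jumps *)

Section SegmentSurjectivity.
Context {R : realType} {n m : nat}.
Variable tau : 'rV[R]_n -> 'rV[R]_m.

Hypothesis off_line : forall x y : 'rV[R]_n, x != y ->
  exists a, affine_indep x y a.

Hypothesis indep_tau : forall x y a : 'rV[R]_n, affine_indep x y a ->
  affine_indep (tau x) (tau y) (tau a).

Hypothesis convex_tau : forall (x y : 'rV[R]_n) (s : R), x != y -> 0 < s -> s < 1 ->
  exists r, [/\ 0 < r, r < 1 & tau (seg_pt x y s) = seg_pt (tau x) (tau y) r].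

(** Approached from [x], the image stays away from [tau u]: parameters in []w, 1[] are skipped. *)
Let left_jump x u := exists2 w : R, w < 1 & forall s, 0 <= s -> s < 1 ->
  exists g, [/\ 0 <= g, g <= w & tau (seg_pt x u s) = seg_pt (tau x) (tau u) g].

Let tau_inj x y : x != y -> tau x != tau y.
Proof.
by move=> /off_line[a /indep_tau]; exact: affine_indep_neq.
Qed.

(** Monotonicity comes from betweenness applied to [x] and [seg_pt x y t], which gives
    [f s = r * f t] with [0 < r < 1]. Outside [[0, 1]] the values of [f] are arbitrary. *)
Let line_param x y : x != y -> exists f : R -> R,
  [/\ f 0 = 0, f 1 = 1,
    forall s, 0 <= s -> s <= 1 -> tau (seg_pt x y s) = seg_pt (tau x) (tau y) (f s)
  & forall s t, 0 <= s -> s < t -> t <= 1 -> 0 <= f s < f t].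
Proof.
move=> xy.
have /choice[f fP] : forall s : R, exists r : R, 0 <= s -> s <= 1 ->
    tau (seg_pt x y s) = seg_pt (tau x) (tau y) r.
  move=> s; have [s0|s0] := leP s 0.
    by exists 0 => s0' _; have -> : s = 0; [lra|rewrite !seg_pt0].
  have [s1|s1] := leP 1 s.
    by exists 1 => _ s1'; have -> : s = 1; [lra|rewrite !seg_pt1].
  by have [r [_ _ ?]] := convex_tau xy s0 s1; exists r.
have inj s t : seg_pt (tau x) (tau y) s = seg_pt (tau x) (tau y) t -> s = t.
  by move=> e; apply/eqP; apply: contraT => /(seg_pt_neq (tau_inj xy)); rewrite e eqxx.
have f0 : f 0 = 0 by apply: inj; rewrite -fP// !seg_pt0.
have f1 : f 1 = 1 by apply: inj; rewrite -fP// !seg_pt1.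
have f01 s : 0 < s -> s <= 1 -> 0 < f s.
  move=> s0; rewrite le_eqVlt => /orP[/eqP->|s1]; first by rewrite f1.
  have [r [r0 _ e]] := convex_tau xy s0 s1.
  by rewrite (inj (f s) r)// -e fP// ltW.
exists f; split => // s t s0 st t1.
have t0 := le_lt_trans s0 st.
move: s0; rewrite le_eqVlt => /orP[/eqP<-|s0]; first by rewrite f0 lexx f01.
have xt : x != seg_pt x y t by rewrite -{1}(seg_pt0 x y) seg_pt_neq// lt_eqF.
have [||r [r0 r1 e]] := convex_tau (s := s / t) xt.
- by rewrite divr_gt0.
- by rewrite ltr_pdivrMr// mul1r.
have -> : f s = r * f t.
  apply: inj; rewrite -fP; [|lra|lra].
  transitivity (tau (seg_pt x (seg_pt x y t) (s / t))).
    by congr tau; apply/rowP => i; rewrite !mxE; field; rewrite gt_eqF.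
  rewrite e fP; [|lra|lra].
  by apply/rowP => i; rewrite !mxE; ring.
have ft := f01 _ t0 t1.
by rewrite mulr_ge0 ?ltW//= gtr_pMl.
Qed.

(* A jump at one point is carried by central projections to jumps at all points
   of a parallel line, but a monotone function has countably many jumps. *)
Let no_left_jump x u : x != u -> left_jump x u -> False.
Proof.
move=> xu [w w1 jump]; have [c xuc] := off_line xu.
(* The line [k] runs halfway between [x u] and its parallel through [c]. Central projection from
   [apex t] takes [u] to [k t], and points before [u] to points [k t'] with [t' < t]. *)
pose k (t : R) := 2^-1 *: u + 2^-1 *: c + (t / 2) *: (u - x).
pose apex (t : R) := c + t *: (u - x).
have kE t : k t = seg_pt (k 0) (k 1) t.
  by apply/rowP => i; rewrite !mxE; ring.
have k01 : k 0 != k 1.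
  apply: contraNneq xu => /rowP h; apply/eqP/rowP => i.
  by have := h i; rewrite !mxE; lra.
have mid t t' : k t' = seg_pt (apex t) (seg_pt x u (1 - t + t')) 2^-1.
  by apply/rowP => i; rewrite !mxE; field.
have apex_indep t : affine_indep x u (apex t).
  move=> p q r pqr e; have [||h1 h2 h3] := xuc (p - r * t) (q + r * t) r.
  - by rewrite -pqr; ring.
  - by rewrite -e; apply/rowP => i; rewrite !mxE; ring.
  by move: h1 h2; rewrite h3 !mul0r subr0 addr0.
have [f [f0 f1 fP fmono]] := line_param k01.
have gap t : 0 < t -> t <= 1 -> exists2 y, y < f t &
    forall t', 0 <= t' -> t' < t -> f t' <= y.
  move=> t0 t1; have ind := indep_tau (apex_indep t).
  have ft0 : 0 < f t by have /andP[_] := fmono 0 t (lexx 0) t0 t1; rewrite f0.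
  have half0 : 0 < 2^-1 :> R by lra.
  have half1 : 2^-1 < 1 :> R by lra.
  have au : apex t != u.
    exact: affine_indep_neq (affine_indepA (affine_indepA (affine_indepC (apex_indep
      t)))).
  have aseg s : apex t != seg_pt x u s.
    apply/eqP => /rowP e; have [||_ _ /eqP] := apex_indep t (1 - s) s (-1).
    - by ring.
    - by apply/rowP => i; have := e i; rewrite !mxE => ->; ring.
    - by rewrite oppr_eq0 oner_eq0.
  have [l [l0 l1 el]] := convex_tau au half0 half1.
  have [||g0 [g00 g0w eg0]] := jump (1 - t); [lra|lra|].
  have [|v [v0 v1 ev]] := convex_tau (x := apex t) (y :=
    seg_pt x u (1 - t)) _ half0 half1.
    exact: aseg.
  have d0 : 0 < v + l * (1 - w) by rewrite addr_gt0// mulr_gt0// subr_gt0.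
  (* Barycentric coordinates of [tau (k t')] in the triangle [tau x], [tau u], [tau (apex t)] give
     [h * l * (1 - g) = (1 - h) * v * (g - g0)] for [h = f t' / f t]. With [g <= w] and
     [g - g0 <= 1] this bounds [h] by the factor used here, which is below 1 because [w < 1]. *)
  exists (v / (v + l * (1 - w)) * f t).
    by rewrite gtr_pMl// ltr_pdivrMr// mul1r ltrDl mulr_gt0// subr_gt0.
  move=> t' t'0 t't; have [||g [g_ge0 gw eg]] := jump (1 - t + t'); [lra|lra|].
  have [|p [p0 p1 ep]] := convex_tau (x := apex t) (y :=
    seg_pt x u (1 - t + t')) _ half0 half1.
    exact: aseg.
  have /andP[ft'0 ft't] := fmono t' t t'0 t't t1.
  pose h := f t' / f t.
  have ftE : f t' = h * f t by rewrite /h divfK// gt_eqF.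
  have h0 : 0 <= h by rewrite divr_ge0// ltW.
  have h1 : h <= 1 by rewrite ler_pdivrMr// mul1r ltW.
  have ek : tau (k t') = seg_pt (tau (k 0)) (tau (k t)) h.
    have -> : tau (k t) = seg_pt (tau (k 0)) (tau (k 1)) (f t) by rewrite kE fP// ltW.
    rewrite (kE t') fP//; last by lra.
    rewrite ftE.
    by apply/rowP => i; rewrite !mxE; ring.
  have [||E1 E2 _] := ind (p * (1 - g) - (1 - h) * v * (1 - g0))
     (p * g - (1 - h) * v * g0 - h * l) (1 - p - (1 - h) * (1 - v) - h * (1 - l)).
  - by ring.
  - move: ek; rewrite (mid t t') ep eg (mid t 0) addr0 ev eg0 (mid t t) subrK seg_pt1
    el.
    by move=> /rowP ek; apply/rowP => i; have := ek i; rewrite !mxE; lra.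
  rewrite ftE ler_pM2r// ler_pdivlMr//.
  have E3 : h * l * (1 - g) = (1 - h) * v * (g - g0).
    have := congr1 ( *%R g) E1; have := congr1 ( *%R (1 - g)) E2; lra.
  have : h * l * (1 - w) <= h * l * (1 - g).
    by rewrite ler_wpM2l//; [rewrite mulr_ge0// ltW|lra].
  have : (1 - h) * v * (g - g0) <= (1 - h) * v * 1.
    by rewrite ler_wpM2l//; [rewrite mulr_ge0//; lra|lra].
  lra.
(* The gaps below the values [f t] are disjoint, so a rational chosen in each would make []0, 1]]
   countable. *)
have /choice[q qP] : forall t : R, exists q : rat, 0 < t -> t <= 1 ->
    ratr q < f t /\ forall t', 0 <= t' -> t' < t -> f t' < ratr q.
  move=> t; have [t0|] := ltP 0 t; last by move=> ? ; exists 0; lra.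
  have [t1|] := leP t 1; last by move=> ?; exists 0; lra.
  have [y yt yP] := gap t t0 t1.
  have [q /=] := rat_in_itvoo yt; rewrite in_itv /= => /andP[yq qt].
  by exists q => _ _; split => // t' t'0 t't; apply: le_lt_trans yq; exact: yP.
apply: (@uncountable_unit_itv R); apply: (@countable_rat_inj _ _ _ q) => s t.
rewrite !inE /= !in_itv /= => /andP[s0 s1] /andP[t0 t1] qst.
have [qs sP] := qP s s0 s1; have [qt tP] := qP t t0 t1.
have [st|ts|//] := ltgtP s t.
  by have := tP s (ltW s0) st; rewrite -qst ltNge (ltW qs).
by have := sP t (ltW t0) ts; rewrite qst ltNge (ltW qt).
Qed.

(** If [w] is missed, the monotone [f] jumps over it at [sup S]. The jump is seen coming from [y]
    when [f (sup S) < w] and from [x] when [w < f (sup S)]; both contradict [no_left_jump]. *)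
Lemma seg_surj x y w : x != y -> 0 <= w -> w <= 1 -> exists s,
  [/\ 0 <= s, s <= 1 & tau (seg_pt x y s) = seg_pt (tau x) (tau y) w].
Proof.
move=> xy w0 w1; have [f [f0 f1 fP fmono]] := line_param xy.
have fmono' s t : 0 <= s -> s < t -> t <= 1 -> f s < f t.
  by move=> s0 st t1; have /andP[] := fmono s t s0 st t1.
apply: contrapT => nw.
have fw s : 0 <= s -> s <= 1 -> f s != w.
  by move=> s0 s1; apply/eqP => e; apply: nw; exists s; rewrite -e fP.
pose S := [set s : R | 0 <= s /\ s <= 1 /\ f s < w].
have S0 : S 0 by rewrite /S /= f0 lt_neqAle w0 andbT; have := fw 0 (lexx 0) ler01;
  rewrite f0.
have supS : has_sup S by split; [exists 0|exists 1 => s [_ []]].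
have s0 : 0 <= sup S by apply: sup_upper_bound.
have s1 : sup S <= 1 by apply: ge_sup; [exists 0|move=> s [_ []]].
have below s : 0 <= s -> s < sup S -> f s < w.
  move=> s0' ss; have e0 : 0 < sup S - s by lra.
  have [t [t0 [t1 ftw]] st] := sup_adherent e0 supS.
  by apply: lt_trans ftw; apply: fmono' => //; lra.
have above s : sup S < s -> s <= 1 -> w < f s.
  move=> ss s1'; have ss0 : 0 <= s by lra.
  rewrite lt_neqAle eq_sym fw//= leNgt; apply/negP => fsw.
  by have := sup_upper_bound supS (conj ss0 (conj s1' fsw)); lra.
have [fsw|wfs|e] := ltgtP (f (sup S)) w; last by have := fw _ s0 s1; rewrite e eqxx.
  have s1' : sup S < 1.
    by rewrite lt_neqAle s1 andbT; apply: contraTneq fsw => ->; rewrite f1 -leNgt.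
  have yp : y != seg_pt x y (sup S).
    by rewrite -{1}(seg_pt1 x y) seg_pt_neq// gt_eqF.
  have fs0 : 0 < 1 - f (sup S) by lra.
  apply: (no_left_jump yp); exists ((1 - w) / (1 - f (sup S))).
    by rewrite ltr_pdivrMr//; lra.
  move=> r r0 r1; pose p := 1 - r + r * sup S.
  have ps : sup S < p.
    by rewrite -subr_gt0 (_ : _ - _ = (1 - r) * (1 - sup S)) ?mulr_gt0 ?subr_gt0 /p//;
      ring.
  have p1 : p <= 1 by have : 0 <= r * (1 - sup S); [rewrite mulr_ge0//; lra|rewrite /p;
    lra].
  exists ((1 - f p) / (1 - f (sup S))); split.
  - rewrite divr_ge0 ?(ltW fs0)// subr_ge0 -f1.
    by move: p1; rewrite le_eqVlt => /orP[/eqP->//|p1]; rewrite ltW// fmono'//; lra.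
  - rewrite ler_pM2r ?invr_gt0//; have := above _ ps p1; lra.
  - have -> : seg_pt y (seg_pt x y (sup S)) r = seg_pt x y p.
      by apply/rowP => i; rewrite !mxE /p; ring.
    rewrite !fP//; [|lra].
    by apply/rowP => i; rewrite !mxE; field; rewrite gt_eqF.
have s0' : 0 < sup S.
  by rewrite lt_neqAle s0 andbT eq_sym; apply: contraTneq wfs => ->; rewrite f0 -leNgt.
have xp : x != seg_pt x y (sup S).
  by rewrite -{1}(seg_pt0 x y) seg_pt_neq// lt_eqF.
have fs0 : 0 < f (sup S) by lra.
apply: (no_left_jump xp); exists (w / f (sup S)).
  by rewrite ltr_pdivrMr//; lra.
move=> r r0 r1; pose p := r * sup S.
have ps : p < sup S by rewrite /p gtr_pMl.
have p0 : 0 <= p by rewrite /p mulr_ge0.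
exists (f p / f (sup S)); split.
- by rewrite divr_ge0 ?(ltW fs0)//; have /andP[] := fmono p (sup S) p0 ps s1.
- by rewrite ler_pM2r ?invr_gt0//; exact: ltW (below _ p0 ps).
- have -> : seg_pt x (seg_pt x y (sup S)) r = seg_pt x y p.
    by apply/rowP => i; rewrite !mxE /p; ring.
  rewrite !fP//; [|lra].
  by apply/rowP => i; rewrite !mxE; field; rewrite gt_eqF.
Qed.

End SegmentSurjectivity.

(** * Linear spans of homogenized sets *)

Section Homogenization.
Context {R : realType} {n : nat}.
Implicit Types (p q : 'rV[R]_n) (A B S : set 'rV[R]_n) (V : {vspace 'rV[R]_(1 + n)}).

(* Homogeneous coordinates [(1, p)]: affine spans become linear spans, and
   [\dim (hspan A)] is one more than the affine dimension of [A]. *)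
Definition hvec p : 'rV[R]_(1 + n) := row_mx (const_mx 1) p.

Lemma scale_hvec a p : a *: hvec p = row_mx (const_mx a) (a *: p).
Proof.
by rewrite /hvec scale_row_mx; congr row_mx; apply/rowP => i; rewrite !mxE mulr1.
Qed.

Lemma hvec_lin2 a b p q : a *: hvec p + b *: hvec q = row_mx (const_mx (a + b)) (a *:
  p + b *: q).
Proof.
by rewrite !scale_hvec add_row_mx; congr row_mx; apply/rowP => i; rewrite !mxE.
Qed.

Lemma hvec_seg p q s : hvec (seg_pt p q s) = (1 - s) *: hvec p + s *: hvec q.
Proof. by rewrite hvec_lin2 subrK. Qed.

Lemma sum_hvec (I : Type) (r : seq I) (l : I -> R) (s : I -> 'rV[R]_n) :
  \sum_(i <- r) l i *: hvec (s i) =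
  row_mx (const_mx (\sum_(i <- r) l i)) (\sum_(i <- r) l i *: s i).
Proof.
elim: r => [|i r IHr].
  rewrite !big_nil -row_mx0; congr row_mx; by apply/rowP => i; rewrite !mxE.
rewrite !big_cons IHr scale_hvec add_row_mx; congr row_mx.
by apply/rowP => j; rewrite !mxE.
Qed.

Lemma scale_hvec_inj a b p q : a != 0 -> a *: hvec p = b *: hvec q -> a = b /\ p = q.
Proof.
move=> a0; rewrite !scale_hvec => /eq_row_mx[/rowP/(_ 0)]; rewrite !mxE => <-.
by move=> /(scalerI a0).
Qed.

Lemma hvec_neq0 p : hvec p != 0.
Proof.
apply/eqP => /rowP/(_ (lshift n 0)); rewrite row_mxEl !mxE => /eqP.
by rewrite oner_eq0.
Qed.

(** [A] may be infinite; a finite list from [A] of largest rank already spans every [hvec p] with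
    [p] in [A]. *)
Let hspan_ex A : exists V, (exists2 X : seq 'rV[R]_n, {in X, forall p, A p} &
  V = <<map hvec X>>%VS) /\ forall p, A p -> hvec p \in V.
Proof.
pose P k := `[< exists2 X : seq 'rV[R]_n, {in X, forall p, A p} &
  \dim <<map hvec X>> = k >].
have P0 : exists k, P k.
  by exists 0; apply/asboolP; exists [::] => //=; rewrite span_nil dimv0.
have Pub k : P k -> (k <= \dim (fullv : {vspace 'rV[R]_(1 + n)}))%N.
  by move=> /asboolP[X _ <-]; exact: dimvS (subvf _).
have [k /asboolP[X XA Xk] kmax] := ex_maxnP P0 Pub.
exists <<map hvec X>>%VS; split; first by exists X.
move=> p Ap; have : P (\dim <<map hvec (p :: X)>>).
  apply/asboolP; exists (p :: X) => // q; rewrite inE => /orP[/eqP->//|]; exact: XA.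
move=> /kmax; rewrite -Xk /= span_cons => h.
have sub : (<<map hvec X>> <= <[hvec p]> + <<map hvec X>>)%VS by exact: addvSr.
have /eqP -> : (<<map hvec X>> == <[hvec p]> + <<map hvec X>>)%VS by rewrite eqEdim sub.
exact: subvP (addvSl _ _) _ (memv_line _).
Qed.

Definition hspan A : {vspace 'rV[R]_(1 + n)} := projT1 (cid (hspan_ex A)).

Lemma hspan_in A p : A p -> hvec p \in hspan A.
Proof. by rewrite /hspan; case: cid => V /= [_]; exact. Qed.

Lemma hspan_seq A : exists2 X : seq 'rV[R]_n, {in X, forall p, A p} &
  hspan A = <<map hvec X>>%VS.
Proof. by rewrite /hspan; case: cid => V /= []. Qed.

Lemma hspan_sub A V : (forall p, A p -> hvec p \in V) -> (hspan A <= V)%VS.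
Proof.
move=> AV; have [X XA ->] := hspan_seq A; apply/span_subvP => _ /mapP[p pX ->].
exact/AV/XA.
Qed.

Lemma hspanS A B : A `<=` B -> (hspan A <= hspan B)%VS.
Proof. by move=> AB; apply: hspan_sub => p /AB; exact: hspan_in. Qed.

End Homogenization.

(** * Countability of families of convex sets with a common span *)

Section RationalPoints.
Context {R : realType} {n : nat}.
Implicit Types (A S : set 'rV[R]_n).

Lemma convex_cone_sum A (I : Type) (r : seq I) (a : R) (l : I -> R) p (s : I ->
  'rV[R]_n) :
  convex_set A -> A p -> 0 <= a -> (forall i, A (s i)) -> (forall i, 0 <= l i) ->
  exists2 m, A m & a *: p + \sum_(i <- r) l i *: s i = (a + \sum_(i <- r) l i) *: m.
Proof.
move=> cA Ap a0 As l0; elim: r => [|i r [m Am e]].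
  by exists p; rewrite // !big_nil !addr0.
have sum0 : 0 <= a + \sum_(i <- r) l i by rewrite addr_ge0// sumr_ge0.
have [z Az ez] := convex_set_weights cA (As i) Am (l0 i) sum0.
exists z => //; rewrite !big_cons addrCA e ez; congr (_ *: _); ring.
Qed.

(* If [p] is in [A] but not in [S], then the cone over the part of [A] near [p]
   has interior points in the linear span of the cone over [A]. *)
Lemma rational_cone_point A S p : closed S -> convex_set A -> A p -> ~ S p ->
  exists r : {ffun 'I_(\dim (hspan A)) -> rat}, exists c : R, exists m,
  [/\ 0 < c, A m, ~ S m &
    \sum_j ratr (r j) *: (vbasis (hspan A))`_j = c *: hvec m].
Proof.
move=> clS cA Ap nSp.
have [e e0 eP] : exists2 e : R, 0 < e & forall m, `|m - p| < e -> ~ S m.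
  have : nbhs p (~` S) by apply: open_nbhs_nbhs; split => //; exact: closed_openC.
  by move=> /nbhs_ballP[e /= e0 he]; exists e => // m me; apply: he;
    rewrite -ball_normE /= distrC.
set V := hspan A; have [X XA VX] := hspan_seq A.
pose k := size X; pose s (i : 'I_k) := X`_i.
have As i : A (s i) by apply: XA; exact: mem_nth.
pose M := \sum_i `|s i - p|.
have M0 : 0 <= M by exact: sumr_ge0.
have M1 : 0 < M + 1 by lra.
(* The weights [l i] below lie between 0 and [2 * d], so the point [m] they produce is at distance
   at most [2 * d * M < e] from [p]. *)
pose d := e / (M + 1) / 2.
have d0 : 0 < d by rewrite !divr_gt0.
have [cf cfP] : exists cf : 'I_(\dim V) -> 'I_k -> R, forall j : 'I_(\dim V),
   (vbasis V)`_j = \sum_i cf j i *: hvec (s i).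
  pose Xt := map_tuple hvec (in_tuple X).
  exists (fun j i => coord Xt i (vbasis V)`_j) => j.
  have jV : (vbasis V)`_j \in <<Xt>>%VS.
    by rewrite -VX; apply: vbasis_mem; rewrite mem_nth// size_tuple.
  rewrite {1}(coord_span jV); apply: eq_bigr => i _; congr (_ *: _).
  by rewrite (nth_map 0).
pose v := hvec p + \sum_i d *: hvec (s i).
have vV : v \in V.
  by apply: memvD; [exact: hspan_in|apply: memv_suml => i _; apply: memvZ; exact:
    hspan_in].
pose C := \sum_j \sum_i `|cf j i|.
have C0 : 0 <= C by apply: sumr_ge0 => j _; exact: sumr_ge0.
have C1 : 0 < C + 1 by lra.
(* Rational coordinates within [h] of those of [v] change each weight [d] by at most [h * C < d], so
   all weights stay nonnegative. *)
pose h := d / (C + 1).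
have h0 : 0 < h by rewrite divr_gt0.
pose a j := coord (vbasis V) j v.
have /choice[r rP] : forall j, exists q : rat, `|ratr q - a j| < h.
  move=> j; have [|q] := @rat_in_itvoo R (a j - h) (a j + h); first by lra.
  by rewrite in_itv /= => /andP[q1 q2]; exists q; rewrite ltr_norml; apply/andP; lra.
pose l i := d + \sum_j (ratr (r j) - a j) * cf j i.
have ld i : `|l i - d| < d.
  rewrite /l addrAC subrr add0r; apply: le_lt_trans (ler_norm_sum _ _ _) _.
  apply: (@le_lt_trans _ _ (h * C)); last first.
    by rewrite /h -mulrA gtr_pMr// mulrC ltr_pdivrMr// mul1r; lra.
  rewrite mulr_sumr; apply: ler_sum => j _.
  rewrite normrM; apply: ler_pM => //; first exact/ltW/rP.
  by rewrite (bigD1 i)//= lerDl sumr_ge0.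
have l0 i : 0 <= l i by have := ld i; rewrite ltr_norml => /andP[? _]; lra.
have l2d i : l i <= 2 * d by have := ld i; rewrite ltr_norml => /andP[_ ?]; lra.
have [m Am em] := convex_cone_sum (index_enum 'I_k) cA Ap ler01 As l0.
have L0 : 0 <= \sum_i l i by exact: sumr_ge0.
have L1 : 0 < 1 + \sum_i l i by lra.
exists [ffun j => r j], (1 + \sum_i l i), m; split => //.
- apply: eP; rewrite scale1r in em.
  have -> : m - p = (1 + \sum_i l i)^-1 *: \sum_i l i *: (s i - p).
    apply: (scalerI (lt0r_neq0 L1)); rewrite scalerA divff ?lt0r_neq0// scale1r.
    rewrite scalerBr -em; under [RHS]eq_bigr do rewrite scalerBr.
    by rewrite sumrB -scaler_suml scalerDl scale1r; rewrite opprD addrACA subrr add0r.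
  rewrite normrZ gtr0_norm ?invr_gt0// -ltr_pdivlMl ?invr_gt0// invrK.
  apply: (@lt_le_trans _ _ e); last by rewrite ler_pMl// lerDl.
  apply: (@le_lt_trans _ _ (2 * d * M)); last first.
    have dE : 2 * d * (M + 1) = e by rewrite /d; field; rewrite gt_eqF.
    by lra.
  apply: le_trans (ler_norm_sum _ _ _) _; rewrite mulr_sumr; apply: ler_sum => i _.
  by rewrite normrZ ger0_norm// ler_wpM2r.
- transitivity (hvec p + \sum_i l i *: hvec (s i)).
    transitivity (v + \sum_j (ratr (r j) - a j) *: (vbasis V)`_j).
      rewrite {1}(coord_vbasis vV) -big_split /=; apply: eq_bigr => j _.
      by rewrite ffunE -scalerDl addrC subrK.
    rewrite /v -addrA; congr (_ + _).
    under [X in _ + X = _]eq_bigr do rewrite cfP scaler_sumr.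
    rewrite exchange_big /= -big_split /=; apply: eq_bigr => i _.
    rewrite /l scalerDl scaler_suml; congr (_ + _); apply: eq_bigr => j _.
    by rewrite scalerA.
  rewrite sum_hvec scale_hvec -em scale1r add_row_mx; congr row_mx.
  by apply/rowP => i; rewrite !mxE.
Qed.

(** All sets share one basis, so each is labelled by a rational vector in its cone. Equal labels
    mean equal rays, hence a common point [m] outside [S]. *)
Lemma countable_hspan (D : set R) (A : R -> set 'rV[R]_n) S V :
  closed S -> (forall i, D i -> convex_set (A i)) ->
  (forall i, D i -> ~ A i `<=` S) ->
  (forall i j, D i -> D j -> i != j -> A i `&` A j `<=` S) ->
  (forall i, D i -> hspan (A i) = V) -> countable D.
Proof.
move=> clS cA nAS AA AV.
have /choice[r rP] : forall i : R, exists r : {ffun 'I_(\dim V) -> rat}, D i ->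
    exists c : R, exists m, [/\ 0 < c, A i m, ~ S m &
      \sum_j ratr (r j) *: (vbasis V)`_j = c *: hvec m].
  move=> i; have [Di|nDi] := pselect (D i); last by exists [ffun=> 0].
  have [p [Ap nSp]] : exists p, A i p /\ ~ S p.
    by apply: contrapT => h; apply: (nAS _ Di) => p Ap; apply: contrapT => nSp; apply:
      h; exists p.
  have [r [c [m h]]] := rational_cone_point clS (cA _ Di) Ap nSp.
  by move: r h; rewrite AV// => r h; exists r => _; exists c, m.
apply: (@countable_rat_inj _ _ _ r) => i j; rewrite !inE => Di Dj rij.
apply/eqP; apply: contraT => ij.
have [c [m [c0 Am nSm e]]] := rP i Di; have [c' [m' [c'0 Am' _]]] := rP j Dj.
rewrite -rij e => /(scale_hvec_inj (lt0r_neq0 c0))[_ mm'].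
by case: nSm; apply: (AA _ _ Di Dj ij); split => //; rewrite mm'.
Qed.

End RationalPoints.

(** * Convex hulls and joins of compact convex sets *)

Section ConvexHulls.
Context {R : realType} {n : nat}.
Implicit Types (A B : set 'rV[R]_n) (C D E : ccset R n).

Lemma convex_seg A x y (s : R) : convex_set A -> A x -> A y -> 0 <= s -> s <= 1 ->
  A (seg_pt x y s).
Proof.
move=> /convex_setP cA Ax Ay s0 s1.
have -> : seg_pt x y s = (1 - s) *: x + (1 - (1 - s)) *: y.
  by apply/rowP => i; rewrite !mxE; ring.
by apply: cA => //; lra.
Qed.

Lemma segs_convex A : (forall x y (s : R), A x -> A y -> 0 <= s -> s <= 1 ->
  A (seg_pt x y s)) -> convex_set A.
Proof.
move=> h; apply/convex_setP => x y t Ax Ay t0 t1.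
have -> : t *: x + (1 - t) *: y = seg_pt x y (1 - t).
  by apply/rowP => i; rewrite !mxE; ring.
by apply: h => //; lra.
Qed.

Lemma sub_hull A : A `<=` convex_hull A.
Proof. by move=> x Ax B [_]; apply. Qed.

Lemma hull_min A B : convex_set B -> A `<=` B -> convex_hull A `<=` B.
Proof. by move=> cB AB; apply: smallest_sub. Qed.

Lemma hullU_seg A B a b z : convex_set A -> convex_set B -> A a -> B b ->
  convex_hull (A `|` B) z ->
  exists u v s, [/\ A u, B v, 0 <= s <= 1 & z = seg_pt u v s].
Proof.
move=> cA cB Aa Bb; pose S := [set z | exists u v s,
  [/\ A u, B v, 0 <= s <= 1 & z = seg_pt u v s]].
suff : convex_hull (A `|` B) `<=` S by apply.
apply: hull_min.
  apply: segs_convex => _ _ r [u [v [s [Au Bv /andP[s0 s1] ->]]]]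
    [u' [v' [s' [Au' Bv' /andP[s'0 s'1] ->]]]] r0 r1.
  have h1 : 0 <= (1 - r) * (1 - s) by rewrite mulr_ge0// subr_ge0.
  have h2 : 0 <= r * (1 - s') by rewrite mulr_ge0// subr_ge0.
  have h3 : 0 <= (1 - r) * s by rewrite mulr_ge0// subr_ge0.
  have h4 : 0 <= r * s' by rewrite mulr_ge0.
  have [p Ap ep] := convex_set_weights cA Au Au' h1 h2.
  have [q Bq eq] := convex_set_weights cB Bv Bv' h3 h4.
  exists p, q, ((1 - r) * s + r * s'); split => //.
    by rewrite addr_ge0//=; lra.
  transitivity (((1 - r) * (1 - s) + r * (1 - s')) *: p +
    ((1 - r) * s + r * s') *: q).
    by rewrite -ep -eq; apply/rowP => i; rewrite !mxE; ring.
  by apply/rowP => i; rewrite !mxE; ring.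
move=> x [Ax|Bx].
  by exists x, b, 0; split => //; rewrite ?lexx ?ler01// seg_pt0.
by exists a, x, 1; split => //; rewrite ?lexx ?ler01// seg_pt1.
Qed.

Lemma convex_mean A (k : nat) (w : 'I_k -> 'rV[R]_n) : (0 < k)%N ->
  convex_set A -> (forall i, A (w i)) -> A (k%:R^-1 *: \sum_i w i).
Proof.
move=> k0 cA Aw; have [m Am] := convex_cone_sum (index_enum 'I_k) cA (Aw (Ordinal k0))
  (lexx 0) Aw (fun=> ler01).
rewrite scale0r !add0r; under eq_bigr do rewrite scale1r.
by move=> ->; rewrite sumr_const card_ord scalerA mulVf ?scale1r// pnatr_eq0 -lt0n.
Qed.

(** The vertices are those of a cross-polytope, plus and minus [n * M] times the unit vectors: a
    point [v] with coordinates at most [M] is the mean of the [n] points [n * v_i] on its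
    diagonals. *)
Lemma bounded_sub_hull C : (0 < n)%N -> exists k, exists2 x : 'I_k -> 'rV[R]_n,
  (0 < k)%N & C `<=` convex_hull (range x).
Proof.
move=> n0; have [M M0 CM] : exists2 M : R, 0 < M &
    forall v, ccset_val C v -> forall i, `|v 0 i| <= M.
  have /ex_strict_bound_gt0[M M0 MP] := compact_bounded (ccset_compact (A := C)).
  exists M => // v Cv i; apply: le_trans (ltW (MP _ Cv)).
  rewrite [leRHS]mx_normrE.
  exact: (le_bigmax 0 (fun ij : 'I_1 * 'I_n => `|v ij.1 ij.2|) (0, i)).
pose x (b : bool * 'I_n) : 'rV[R]_n := ((-1) ^+ b.1 * (n%:R * M)) *: delta_mx 0 b.2.
pose y (i : 'I_#|{: bool * 'I_n}|) := x (enum_val i).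
exists #|{: bool * 'I_n}|, y.
  by rewrite card_prod card_bool card_ord muln_gt0.
move=> v Cv; have xH b : convex_hull (range y) (x b).
  by apply: sub_hull; exists (enum_rank b) => //; rewrite /y enum_rankK.
have nR0 : (n%:R : R) != 0 by rewrite pnatr_eq0 -lt0n.
have -> : v = n%:R^-1 *: \sum_(i < n) (n%:R * v 0 i) *: delta_mx 0 i.
  rewrite {1}(row_sum_delta v) scaler_sumr; apply: eq_bigr => i _.
  by rewrite scalerA mulrA mulVf// mul1r.
apply: convex_mean => //; first exact: convex_set_hull.
move=> i; have := CM _ Cv i; rewrite ler_norml => /andP[v1 v2].
have -> : (n%:R * v 0 i) *: delta_mx 0 i =
    seg_pt (x (false, i)) (x (true, i)) ((1 - v 0 i / M) / 2).
  by apply/rowP => j; rewrite !mxE /= expr0 expr1; field; rewrite gt_eqF.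
apply: convex_seg; [exact: convex_set_hull|exact: xH..| |].
  by rewrite divr_ge0// subr_ge0 ler_pdivrMr// mul1r.
have : - 1 <= v 0 i / M by rewrite ler_pdivlMr// mulN1r.
lra.
Qed.

Lemma ccset_ext C D : C = D :> set 'rV[R]_n -> C = D.
Proof. exact: val_inj. Qed.

Lemma joinl C D : C `<=` Order.join C D.
Proof. by move=> x Cx; rewrite ccset_joinE; apply: sub_hull; left. Qed.

Lemma joinr C D : D `<=` Order.join C D.
Proof. by move=> x Dx; rewrite ccset_joinE; apply: sub_hull; right. Qed.

Lemma join_min C D E : C `<=` E -> D `<=` E -> Order.join C D `<=` E.
Proof.
by move=> CE DE; rewrite ccset_joinE; apply: hull_min; [exact:
  ccset_convex|rewrite subUset].
Qed.

Lemma join_seg C D x y (s : R) : ccset_val C x -> ccset_val D y -> 0 <= s -> s <= 1 ->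
  ccset_val (Order.join C D) (seg_pt x y s).
Proof.
move=> Cx Dy s0 s1; apply: convex_seg => //; first exact: ccset_convex.
  exact: joinl.
exact: joinr.
Qed.

Lemma join_inv C D x y z : ccset_val C x -> ccset_val D y ->
  ccset_val (Order.join C D) z ->
  exists u v s, [/\ ccset_val C u, ccset_val D v, 0 <= s <= 1 & z = seg_pt u v s].
Proof.
by move=> Cx Dy; rewrite ccset_joinE; apply: hullU_seg; first [exact:
  ccset_convex|eassumption].
Qed.

Lemma join1_inv C (b x z : 'rV[R]_n) : ccset_val C x ->
  ccset_val (Order.join C (ccset1 b)) z ->
  exists u s, [/\ ccset_val C u, 0 <= s <= 1 & z = seg_pt u b s].
Proof.
move=> Cx; have b1 : ccset_val (ccset1 b) b by [].
by move=> /(join_inv Cx b1)[u [_ [s [Cu -> s01 ->]]]]; exists u, s.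
Qed.

Lemma seg_inv (x y z : 'rV[R]_n) : ccset_val (Order.join (ccset1 x) (ccset1 y)) z ->
  exists2 s : R, 0 <= s <= 1 & z = seg_pt x y s.
Proof.
have x1 : ccset_val (ccset1 x) x by [].
by move=> /(join1_inv x1)[_ [s [-> s01 ->]]]; exists s.
Qed.

Lemma seg_in (x y : 'rV[R]_n) (s : R) : 0 <= s -> s <= 1 ->
  ccset_val (Order.join (ccset1 x) (ccset1 y)) (seg_pt x y s).
Proof. exact: join_seg. Qed.

End ConvexHulls.

(** * Elementary consequences of preserving meets and joins *)

Section Forward.
Context {R : realType} {c d : nat}.
Variable Phi : ccset R c -> ccset R d.
Hypothesis PhiI : Order.meet_morphism Phi.
Hypothesis PhiU : Order.join_morphism Phi.

Lemma hom_mono (A B : ccset R c) : A `<=` B -> Phi A `<=` Phi B.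
Proof.
move=> AB; have <- : Order.meet A B = A.
  by apply: ccset_ext; rewrite ccset_meetE; exact: setIidl.
by rewrite PhiI => x; rewrite ccset_meetE => -[].
Qed.

Lemma hom_meet (A B C : ccset R c) : A `&` B `<=` C -> Phi A `&` Phi B `<=` Phi C.
Proof.
move=> ABC; rewrite -ccset_meetE -PhiI; apply: hom_mono.
by rewrite ccset_meetE.
Qed.

(** [PhiU] handles binary joins only, so the polytope is covered by a fold of joins; the fold starts
    at the empty set, whence the hypothesis on [Phi ccset0]. *)
Lemma hom_polytope (A : set 'rV[R]_d) k (x : 'I_k -> 'rV[R]_c) (C : ccset R c) :
  convex_set A -> Phi ccset0 `<=` A -> (forall i, Phi (ccset1 (x i)) `<=` A) ->
  C `<=` convex_hull (range x) -> Phi C `<=` A.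
Proof.
move=> cA FA xA Cx.
pose J (s : seq 'I_k) := foldr (fun i D => Order.join (ccset1 (x i)) D) ccset0 s.
have JA s : Phi (J s) `<=` A.
  elim: s => [//|i s IHs] /=; rewrite PhiU ccset_joinE.
  by apply: hull_min; rewrite // subUset; split; [exact: xA|exact: IHs].
apply: subset_trans (JA (index_enum 'I_k)); apply: hom_mono.
apply: (subset_trans Cx); apply: hull_min; first exact: ccset_convex.
have J_in s i : i \in s -> ccset_val (J s) (x i).
  elim: s => [//|j s IHs]; rewrite inE => /orP[/eqP->|/IHs h] /=.
    exact: (@joinl _ _ (ccset1 (x j)) (J s)).
  exact: (@joinr _ _ (ccset1 (x j)) (J s)).
by move=> _ [i _ <-]; apply: J_in; rewrite mem_index_enum.
Qed.

Hypothesis c_gt0 : (0 < c)%N.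
Hypothesis nontrivial : ~ trivial_map Phi.

(** Suppose the image of [x] is inside [Phi ccset0]. Every other [z] is the midpoint of [x] and some
    [y], so its image lies in the image of [y], hence in [Phi ccset0] by disjointness. Then all
    polytopes, and so all sets, have the image [Phi ccset0]. *)
Lemma nonempty_point (x : 'rV[R]_c) : exists2 p, ccset_val (Phi (ccset1 x)) p & ~
  ccset_val (Phi ccset0) p.
Proof.
apply: contrapT => h; apply: nontrivial; exists (Phi ccset0) => C.
have xF : Phi (ccset1 x) `<=` Phi ccset0.
  by move=> p Pp; apply: contrapT => nF; apply: h; exists p.
have F0 D : Phi ccset0 `<=` Phi D by apply: hom_mono.
have PF z : Phi (ccset1 z) `<=` Phi ccset0.
  have [->//|zx] := eqVneq z x.
  pose y := 2 *: z - x.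
  have zy : z != y.
    apply: contraNneq zx => /rowP e; apply/eqP/rowP => i.
    by have := e i; rewrite !mxE; lra.
  have sub : Phi (ccset1 z) `<=` Phi (ccset1 y).
    apply: (@subset_trans _ (Phi (Order.join (ccset1 x) (ccset1 y)))).
      apply: hom_mono => _ ->; have -> : z = seg_pt x y 2^-1.
        by apply/rowP => i; rewrite !mxE; field.
      by apply: join_seg => //; lra.
    rewrite PhiU ccset_joinE; apply: hull_min; first exact: ccset_convex.
    by rewrite subUset; split => //; exact: subset_trans xF _.
  move=> p Pp; apply: (@hom_meet (ccset1 z) (ccset1 y)); last by split => //; exact:
    sub.
  by move=> _ [-> /eqP]; rewrite (negPf zy).
apply: ccset_ext; apply/seteqP; split => //.
have [k [w k0 Cw]] := bounded_sub_hull C c_gt0.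
by apply: hom_polytope Cw => //; exact: ccset_convex.
Qed.

End Forward.

Lemma exists_notin (K : fieldType) (vT : vectType K) (D : {vspace vT}) :
  (\dim D < \dim {:vT})%N -> exists v, v \notin D.
Proof.
move=> h; apply: contrapT => h'; move: h; rewrite ltnNge => /negP; apply.
by apply: dimvS; apply/subvP => v _; apply: contrapT => /negP vD; apply: h'; exists v.
Qed.

(** * Dimensions of images *)

Section Dimensions.
Context {R : realType} {c d : nat}.
Variable Phi : ccset R c -> ccset R d.
Hypothesis PhiI : Order.meet_morphism Phi.
Hypothesis PhiU : Order.join_morphism Phi.
Hypothesis c_gt0 : (0 < c)%N.
Hypothesis nontrivial : ~ trivial_map Phi.

(* The images of the sets [C `|` {b s}] meet pairwise inside [Phi C], so only
   countably many of them can span the same space. *)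
Lemma pencil (C : ccset R c) (b : R -> 'rV[R]_c)
    (V W : {vspace 'rV[R]_(1 + d)}) :
  (forall s t : R, s != t -> 0 < s <= 1 -> 0 < t <= 1 ->
    Order.join C (ccset1 (b s)) `&` Order.join C (ccset1 (b t)) `<=` C) ->
  (forall s : R, 0 < s <= 1 -> ~ ccset_val C (b s)) ->
  exists s : R, [/\ 0 < s <= 1, hspan (Phi (Order.join C (ccset1 (b s)))) != V &
    hspan (Phi (Order.join C (ccset1 (b s)))) != W].
Proof.
move=> bC nC; pose A s := Phi (Order.join C (ccset1 (b s))) : set 'rV[R]_d.
have cnt U : countable [set s : R | 0 < s <= 1 /\ hspan (A s) = U].
  apply: (@countable_hspan _ _ _ A (Phi C) U).
  - by apply: compact_closed; [exact: norm_hausdorff|exact: ccset_compact].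
  - by move=> i _; exact: ccset_convex.
  - move=> i [i01 _] AS; have [p Pp nFp] := nonempty_point PhiI PhiU c_gt0 nontrivial (b
    i).
    apply: nFp; apply: (hom_meet PhiI (A := ccset1 (b i)) (B := C)).
      by move=> _ [-> ]; apply: (nC _ i01).
    split => //; apply: AS; apply: hom_mono Pp => //; exact: joinr.
  - move=> i j [i01 _] [j01 _] ij; apply: hom_meet => //; exact: bC.
  - by move=> i [].
apply: contrapT => h; apply: (@uncountable_unit_itv R).
apply: (@sub_countable _ _ _ (\bigcup_(i in [set: bool])
  [set s : R | 0 < s <= 1 /\ hspan (A s) = if i then V else W])); last first.
  exact: bigcup_countable.
apply: subset_card_le => s /=; rewrite in_itv /= => s01.
have [eV|nV] := eqVneq (hspan (A s)) V; first by exists true.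
have [eW|nW] := eqVneq (hspan (A s)) W; first by exists false.
by exfalso; apply: h; exists s.
Qed.

(** Some segment from [x] to a point of [y a] has an image whose span is neither that of [x] nor
    that of the triangle; the two strict inclusions give the [+ 2]. *)
Lemma rank_triangle x y a : affine_indep x y a ->
  (\dim (hspan (Phi (ccset1 x))) + 2 <=
   \dim (hspan (Phi (Order.join (ccset1 x) (Order.join (ccset1 y) (ccset1 a))))))%N.
Proof.
move=> xya; set V := hspan (Phi (Order.join _ _)); set W := hspan _.
rewrite leqNgt; apply/negP => h.
have yaj s : 0 < s <= 1 -> Order.join (ccset1 x) (ccset1 (seg_pt y a s)) `<=`
    Order.join (ccset1 x) (Order.join (ccset1 y) (ccset1 a)).
  move=> /andP[s0 s1]; apply: join_min; first exact: joinl.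
  move=> _ ->; apply: joinr; apply: join_seg => //; exact: ltW.
have [||s [s01 /eqP sV /eqP sW]] := pencil (C := ccset1 x) (b := seg_pt y a) V W.
- move=> s t st _ _ z [] /seg_inv[u u01 ->] /seg_inv[v v01 /rowP e].
  have [||e1 e2 e3] := xya (v - u) (u * (1 - s) - v * (1 - t)) (u * s - v * t).
  + by ring.
  + by apply/rowP => i; have := e i; rewrite !mxE; lra.
  have uv : u = v by lra.
  have : u * (s - t) = 0 by rewrite mulrBr {2}uv.
  move/eqP; rewrite mulf_eq0 subr_eq0 (negPf st) orbF => /eqP ->.
  exact: seg_pt0.
- move=> s _ e; have [||/eqP] := xya (-1) (1 - s) s;
  [ring| |by rewrite oppr_eq0 oner_eq0].
  by apply/rowP => i; have /rowP/(_ i) := e; rewrite !mxE; lra.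
have WA : (W <= hspan (Phi (Order.join (ccset1 x) (ccset1 (seg_pt y a s)))))%VS.
  apply: hspanS; apply: hom_mono => //; exact: joinl.
have AV : (hspan (Phi (Order.join (ccset1 x) (ccset1 (seg_pt y a s)))) <= V)%VS.
  apply: hspanS; apply: hom_mono => //; exact: yaj.
case: (leqP (\dim (hspan (Phi (Order.join (ccset1 x) (ccset1 (seg_pt y a s)))))) (\dim
  W)) => dW.
  by apply: sW; apply/eqP; rewrite eq_sym eqEdim WA.
by apply: sV; apply/eqP; rewrite eqEdim AV /=; lia.
Qed.

(** Codimension two leaves [e1] and [e2] independent modulo [D]. The directions [e1 + s *: e2] are
    then pairwise independent modulo [D], so the joins can meet only in [C]. *)
Lemma pencil_direction (D : {vspace 'rV[R]_c}) (C : ccset R c) x0 :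
  ccset_val C x0 -> (forall x, ccset_val C x -> x - x0 \in D) -> (\dim D + 2 <= c)%N ->
  exists2 b : R -> 'rV[R]_c, forall s, b s - x0 \notin D &
  forall s t, s != t ->
    Order.join C (ccset1 (b s)) `&` Order.join C (ccset1 (b t)) `<=` C.
Proof.
move=> Cx0 CD Dc; have dimc : \dim {:'rV[R]_c} = c by rewrite dimvf /dim /= mul1n.
have [|e1 e1D] := @exists_notin _ _ D; first by rewrite dimc; lia.
have [|e2 e2D] := @exists_notin _ _ (D + <[e1]>)%VS.
  rewrite dimc; have [+ _] := dimv_add_leqif D <[e1]>%VS.
  by rewrite dim_vline; case: (_ != _) => /=; lia.
have e1D' : forall (a b : R), a *: e1 + b *: e2 \in D -> a = 0 /\ b = 0.
  move=> a b abD; have b0 : b = 0.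
    apply: contraNeq e2D => b0; rewrite -[e2](scalerK b0) memvZ//.
    rewrite -[b *: e2](addKr (a *: e1)) memvD//.
      by rewrite -scaleNr (subvP (addvSr _ _))// memvZ// memv_line.
    exact: subvP (addvSl _ _) _ abD.
  split => //; move: abD; rewrite b0 scale0r addr0 => aD.
  by apply: contraNeq e1D => a0; rewrite -[e1](scalerK a0) memvZ.
exists (fun s => x0 + (e1 + s *: e2)) => [s|s t st z].
  by rewrite [x0 + _]addrC addrK; apply/negP; rewrite -[e1]scale1r => /e1D'[/eqP];
    rewrite oner_eq0.
case=> /(join1_inv Cx0)[x [u [Cx u01 ->]]] /(join1_inv Cx0)[y [v [Cy v01 e]]].
have [] := e1D' (u - v) (u * s - v * t).
  have -> : (u - v) *: e1 + (u * s - v * t) *: e2 = (1 - v) *: (y - x0) - (1 - u) *: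
    (x - x0).
    by apply/rowP => i; have /rowP/(_ i) := e; rewrite !mxE; lra.
  by apply: memvB; apply: memvZ; exact: CD.
move=> uv; have {uv} <- : u = v by lra.
rewrite -mulrBr => /eqP; rewrite mulf_eq0 subr_eq0 (negPf st) orbF => /eqP ->.
by rewrite seg_pt0.
Qed.

(** The pencil avoids [hspan (Phi C)], which makes the rank grow, and [fullv] of dimension [1 + d],
    which keeps it at most [d]. *)
Lemma rank_extend (D : {vspace 'rV[R]_c}) (C : ccset R c) x0 :
  ccset_val C x0 -> (forall x, ccset_val C x -> x - x0 \in D) -> (\dim D + 2 <= c)%N ->
  exists b : 'rV[R]_c, [/\
    forall x, ccset_val (Order.join C (ccset1 b)) x -> x - x0 \in (D + <[b - x0]>)%VS,
    (\dim (hspan (Phi C)) < \dim (hspan (Phi (Order.join C (ccset1 b)))))%N &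
    (\dim (hspan (Phi (Order.join C (ccset1 b)))) <= d)%N].
Proof.
move=> Cx0 CD Dc; have [b bD bC] := pencil_direction Cx0 CD Dc.
have [s t st _ _| s _ /CD | s [s01 sV sW]] := pencil (C := C) (b :=
  b) (hspan (Phi C)) fullv.
- exact: bC.
- by rewrite (negPf (bD s)).
exists (b s); split.
- move=> _ /(join1_inv Cx0)[x [u [Cx u01 ->]]].
  have -> : seg_pt x (b s) u - x0 = (1 - u) *: (x - x0) + u *: (b s - x0).
    by apply/rowP => i; rewrite !mxE; ring.
  by apply: memv_add; apply: memvZ; [exact: CD|exact: memv_line].
- rewrite ltnNge; apply: contra sV => le; rewrite eq_sym eqEdim le andbT.
  by apply: hspanS; apply: hom_mono => //; exact: joinl.
- rewrite -ltnS -add1n ltnNge; apply: contra sW => le.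
  by rewrite eqEdim subvf dimvf /dim /= mul1n.
Qed.

Hypothesis dE : d = c.+1.

(* Adding a generic point raises the rank while the codimension is at least two,
   and does not fill the whole space; counting down from codimension two leaves
   no room for a larger rank. *)
Lemma rank_bound k m (D : {vspace 'rV[R]_c}) (C : ccset R c) x0 :
  ccset_val C x0 -> (forall x, ccset_val C x -> x - x0 \in D) ->
  (\dim D <= m)%N -> (m + k.+2 = c)%N -> (\dim (hspan (Phi C)) <= m.+2)%N.
Proof.
elim: k m D C x0 => [|k IHk] m D C x0 Cx0 CD Dm mc.
  (* Here [m + 2 = c] and [d = c + 1]: the rank is strictly below a rank that is at most [d], hence
     at most [m + 2]. *)
  by have [|b [_ h1 h2]] := rank_extend Cx0 CD; lia.
have [|b [bD h1 h2]] := rank_extend Cx0 CD; first by lia.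
have := IHk m.+1 (D + <[b - x0]>)%VS (Order.join C (ccset1 b)) x0 (joinl Cx0) bD.
have [+ _] := dimv_add_leqif D <[b - x0]>%VS.
have : (\dim <[b - x0]> <= 1)%N by rewrite dim_vline; case: (_ != _).
move=> l1 l2 l3.
have l4 : (\dim (D + <[b - x0]>) <= m.+1)%N.
  by apply: (leq_trans l2); rewrite -[m.+1]addn1; exact: leq_add.
have l5 : (m.+1 + k.+2 = c)%N by lia.
by have := l3 l4 l5; lia.
Qed.

Lemma rank_point x : (3 <= c)%N -> (\dim (hspan (Phi (ccset1 x))) <= 2)%N.
Proof.
move=> c3; apply: (@rank_bound (c - 2) 0 0%VS (ccset1 x) x) => //.
- by move=> _ ->; rewrite subrr mem0v.
- by rewrite dimv0.
- by lia.
Qed.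

Lemma rank_segment x y : (3 <= c)%N ->
  (\dim (hspan (Phi (Order.join (ccset1 x) (ccset1 y)))) <= 3)%N.
Proof.
move=> c3; apply: (@rank_bound (c - 3) 1 <[y - x]>%VS (Order.join (ccset1 x) (ccset1 y))
  x) => //.
- exact: joinl.
- move=> _ /seg_inv[u _ ->].
  have -> : seg_pt x y u - x = u *: (y - x) by apply/rowP => i; rewrite !mxE; ring.
  exact: memvZ (memv_line _).
- by rewrite dim_vline; case: (_ != _).
- by lia.
Qed.

End Dimensions.

(** * Spans of two, three and four vectors *)

Section Spans.
Context {R : realType} {n : nat}.
Implicit Types (u v w o : 'rV[R]_n).

Lemma mem_span_cons u (X : seq 'rV[R]_n) w : w \in <<u :: X>>%VS ->
  exists a, exists2 w', w' \in <<X>>%VS & w = a *: u + w'.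
Proof.
rewrite span_cons => /memv_addP[_ /vlineP[a ->] [w' w'X ->]].
by exists a, w'.
Qed.

Lemma mem_span2 u v w : w \in <<[:: u; v]>>%VS -> 
  exists a b, w = a *: u + b *: v.
Proof.
case/mem_span_cons => a [w'] /mem_span_cons[b [w'']]; rewrite span_nil memv0.
by move=> /eqP -> -> ->; exists a, b; rewrite addr0.
Qed.

Lemma mem_span3 u v w x : x \in <<[:: u; v; w]>>%VS ->
  exists a b c, x = a *: u + b *: v + c *: w.
Proof.
by case/mem_span_cons => a [w'] /mem_span2[b [c ->]] ->; exists a, b, c; rewrite addrA.
Qed.

Lemma span_eq_of_free (V : {vspace 'rV[R]_n}) (X : seq 'rV[R]_n) : free X ->
  {in X, forall v, v \in V} -> (\dim V <= size X)%N -> V = <<X>>%VS.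
Proof.
move=> fX XV dV; apply/eqP; rewrite eq_sym eqEdim; apply/andP; split.
  exact/span_subvP.
by rewrite (eqP fX).
Qed.

Lemma free_cons_eq0 u (X : seq 'rV[R]_n) a w : free (u :: X) -> w \in <<X>>%VS ->
  a *: u + w = 0 -> a = 0 /\ w = 0.
Proof.
rewrite free_cons => /andP[uX _] wX e; have a0 : a = 0.
  apply: contraNeq uX => a0; rewrite -[u](scalerK a0) memvZ//.
  by rewrite -[a *: u](addrK w) e sub0r memvN.
by split => //; rewrite -e a0 scale0r add0r.
Qed.

Lemma free3P u v w : free [:: u; v; w] -> forall r s t : R,
  r *: u + s *: v + t *: w = 0 -> [/\ r = 0, s = 0 & t = 0].
Proof.
move=> fr r s t; rewrite -addrA; move: (fr) => /free_cons_eq0 h /h[|-> ].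
  by rewrite memvD// memvZ// memv_span// !inE eqxx ?orbT.
move: fr; rewrite free_cons => /andP[_ fr]; move: (fr) => /free_cons_eq0 {}h /h[|-> ].
  by rewrite memvZ// memv_span// mem_head.
move: fr; rewrite free_cons => /andP[_ fr] /eqP.
by rewrite scaler_eq0 -[w == 0]negbK -seq1_free fr orbF => /eqP ->.
Qed.

Lemma linear_indep4P u v w o : (4 <= \dim <<[:: u; v; w; o]>>)%N ->
  linear_indep4 u v w o.
Proof.
move=> d4; have fr : free [:: u; v; w; o] by rewrite /free eqn_leq dim_span.
move=> r s t q; rewrite -2!addrA; move: (fr) => /free_cons_eq0 h /h[|-> ].
  by rewrite !memvD// memvZ// memv_span// !inE eqxx ?orbT.
move: fr; rewrite free_cons => /andP[_ fr]; rewrite addrA.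
by move=> /(free3P fr)[-> -> ->].
Qed.

End Spans.

(** * Spans and cones of homogenized sets *)

Section HspanLemmas.
Context {R : realType} {n : nat}.
Implicit Types (A B : set 'rV[R]_n).

Lemma hspan_hull A : (hspan (convex_hull A) <= hspan A)%VS.
Proof.
apply: hspan_sub => p; suff : convex_hull A `<=` [set q :
  'rV[R]_n | hvec q \in hspan A] by apply.
apply: hull_min; last by move=> q; exact: hspan_in.
by apply: segs_convex => x y s /= Ax Ay _ _; rewrite hvec_seg memvD// memvZ.
Qed.

Lemma hspanU A B : (hspan (A `|` B) <= hspan A + hspan B)%VS.
Proof.
apply: hspan_sub => p [/hspan_in|/hspan_in]; apply/subvP; first exact: addvSl.
exact: addvSr.
Qed.

Lemma free_hvec2 (p q : 'rV[R]_n) : p != q -> free [:: hvec p; hvec q].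
Proof.
move=> pq; rewrite free_cons free_cons nil_free andbT span_nil memv0 hvec_neq0 andbT.
rewrite span_seq1; apply/vlineP => -[k].
rewrite -[LHS]scale1r => /(scale_hvec_inj (oner_neq0 _))[_ e].
by rewrite e eqxx in pq.
Qed.

Lemma hspan_gt0 A p : A p -> (0 < \dim (hspan A))%N.
Proof.
move=> /hspan_in Ap; rewrite lt0n dimv_eq0; apply: contraTneq Ap => ->.
by rewrite memv0 hvec_neq0.
Qed.

Lemma hspan_eq1 A p q : (\dim (hspan A) < 2)%N -> A p -> A q -> p = q.
Proof.
move=> d1 Ap Aq; apply/eqP; apply: contraTT d1 => /free_hvec2 fr; rewrite -leqNgt.
rewrite -[2%N]/(size [:: hvec p; hvec q]) -(eqP fr); apply: dimvS.
by apply/span_subvP => z; rewrite !inE => /orP[]/eqP->; exact: hspan_in.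
Qed.

Lemma cone2 A p q (a b : R) : convex_set A -> A p -> A q -> 0 <= a -> 0 <= b ->
  exists2 m, A m & a *: hvec p + b *: hvec q = (a + b) *: hvec m.
Proof.
move=> cA Ap Aq a0 b0; have [m Am e] := convex_set_weights cA Ap Aq a0 b0.
by exists m => //; rewrite hvec_lin2 e scale_hvec.
Qed.

Lemma cone3 A p q r (a b c : R) : convex_set A -> A p -> A q -> A r ->
  0 <= a -> 0 <= b -> 0 <= c ->
  exists2 m, A m & a *: hvec p + b *: hvec q + c *: hvec r = (a + b + c) *: hvec m.
Proof.
move=> cA Ap Aq Ar a0 b0 c0; have [m Am ->] := cone2 cA Ap Aq a0 b0.
exact: cone2 (addr_ge0 a0 b0) c0.
Qed.

(** The ends are where a coordinate that separates two points of [A] attains its minimum and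
    maximum. *)
Lemma compact_segment A : compact A -> A !=set0 -> (\dim (hspan A) <= 2)%N ->
  exists u v, [/\ A u, A v &
    forall p, A p -> exists2 s, 0 <= s <= 1 & p = seg_pt u v s].
Proof.
move=> kA A0 d2; have [[p [q [Ap Aq pq]]]|h] := pselect (exists p q, [/\
  A p, A q & p != q]);
  last first.
  have [u Au] := A0; exists u, u; split=> // p Ap; exists 0; rewrite ?lexx ?ler01//.
  rewrite seg_pt0; apply/eqP; apply: contrapT => /negP pu; apply: h; by exists p, u.
have [j pqj] : exists j, p 0 j != q 0 j.
  apply: contrapT => h; move/eqP: pq; apply; apply/rowP => j; apply/eqP.
  by apply: contrapT => /negP pqj; apply: h; exists j.
have cj : {within A, continuous (fun x : 'rV[R]_n => x 0 j)}.
  by apply: continuous_subspaceT; exact: coord_continuous.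
have [u + umin] := EVT_min_rV A0 kA cj; have [v + vmax] := EVT_max_rV A0 kA cj.
rewrite !inE => Av Au; exists u, v; split => // x Ax.
have uv : u 0 j < v 0 j.
  move: pqj; rewrite neq_lt => /orP[] h.
    by apply: le_lt_trans (lt_le_trans h _); [apply: umin|apply: vmax]; rewrite inE.
  by apply: le_lt_trans (lt_le_trans h _); [apply: umin|apply: vmax]; rewrite inE.
have neq : u != v by apply: contraTneq uv => ->; rewrite ltxx.
have := hspan_in Ax; rewrite (span_eq_of_free (free_hvec2 neq) _ d2); last first.
  by move=> z; rewrite !inE => /orP[]/eqP->; exact: hspan_in.
move=> /mem_span2[a [b]]; rewrite hvec_lin2 => /eq_row_mx[/rowP/(_ 0)].
rewrite !mxE => ab ex; exists b.
  have ujx : u 0 j <= x 0 j by apply: umin; rewrite inE.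
  have xjv : x 0 j <= v 0 j by apply: vmax; rewrite inE.
  have xE : x 0 j - u 0 j = b * (v 0 j - u 0 j).
    by rewrite ex !mxE; have -> : a = 1 - b; [lra|ring].
  have d0 : 0 < v 0 j - u 0 j by lra.
  rewrite -(pmulr_lge0 _ d0) -xE subr_ge0 ujx /=.
  by rewrite -(ler_pM2r d0) -xE mul1r; lra.
by rewrite ex /seg_pt; congr (_ *: _ + _); lra.
Qed.

End HspanLemmas.

(** * The images of points have a convex union *)

Section Homomorphism.
Context {R : realType} {c : nat}.
Variable Phi : ccset R c -> ccset R c.+1.
Hypothesis PhiI : Order.meet_morphism Phi.
Hypothesis PhiU : Order.join_morphism Phi.
Hypothesis c3 : (3 <= c)%N.
Hypothesis nontrivial : ~ trivial_map Phi.

Local Notation P x := (ccset_val (Phi (ccset1 x))).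
Local Notation F := (ccset_val (Phi ccset0)).
Local Notation J x y := (Order.join (ccset1 x) (ccset1 y)).

Let c_gt0 : (0 < c)%N. Proof. by apply: leq_trans c3. Qed.

Let cvx (C : ccset R c) : convex_set (Phi C). Proof. exact: ccset_convex. Qed.

Lemma F_sub (C : ccset R c) : F `<=` Phi C.
Proof. exact: hom_mono. Qed.

Lemma point_disjoint x y p : x != y -> P x p -> P y p -> F p.
Proof.
move=> xy Pxp Pyp; apply: (hom_meet PhiI (A := ccset1 x) (B := ccset1 y)); last by
  split.
by move=> _ [-> /eqP]; rewrite (negPf xy).
Qed.

Lemma off_line (x y : 'rV[R]_c) : x != y -> exists a, affine_indep x y a.
Proof.
move=> xy; have [|e eD] := @exists_notin _ _ <[y - x]>%VS.
  by rewrite dim_vline dimvf /dim /= mul1n; case: (_ != _) => //=; lia.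
exists (x + e) => r s t rst e0.
have e1 : s *: (y - x) + t *: e = 0.
  rewrite -e0; apply/rowP => i; rewrite !mxE; have -> : r = - s - t by lra.
  by ring.
have t0 : t = 0.
  apply: contraNeq eD => t0; rewrite -[e](scalerK t0) memvZ//.
  rewrite -[t *: e](addKr (s *: (y - x))) e1 addr0 -scaleNr memvZ//.
  exact: memv_line.
move: e1; rewrite t0 scale0r addr0 => /eqP; rewrite scaler_eq0 subr_eq0 [y == x]eq_sym
  (negPf xy) orbF.
by move=> /eqP s0; split => //; lra.
Qed.

Lemma affine_indep_dec (x y b : 'rV[R]_c) : x != y ->
  affine_indep x y b \/ exists s, b = seg_pt x y s.
Proof.
move=> xy; have [[s ->]|h] := pselect (exists s, b = seg_pt x y s); first by right;
  exists s.
left=> r s t rst e.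
have t0 : t = 0.
  apply/eqP; apply: contrapT => /negP t0; apply: h; exists (- s / t).
  apply: (scalerI t0); apply/rowP => i; move/rowP/(_ i): e; rewrite !mxE => e.
  transitivity (- (r * x 0 i + s * y 0 i)); first by lra.
  by have -> : r = - s - t; [lra|field].
move: e; rewrite t0 scale0r addr0; have -> : r = - s by lra.
rewrite scaleNr addrC -scalerBr => /eqP; rewrite scaler_eq0 subr_eq0 [y == x]eq_sym
  (negPf xy) orbF.
by move=> /eqP ->; rewrite oppr0.
Qed.

Lemma image_joinl x y : P x `<=` Phi (J x y).
Proof. by apply: hom_mono => //; exact: joinl. Qed.

Lemma image_joinr x y : P y `<=` Phi (J x y).
Proof. by apply: hom_mono => //; exact: joinr. Qed.

Lemma between_image x y s p : 0 <= s -> s <= 1 -> P (seg_pt x y s) p ->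
  exists u v r, [/\ P x u, P y v, 0 <= r <= 1 & p = seg_pt u v r].
Proof.
move=> s0 s1 Pp; have [u Pu _] := nonempty_point PhiI PhiU c_gt0 nontrivial x.
have [v Pv _] := nonempty_point PhiI PhiU c_gt0 nontrivial y.
have : ccset_val (Phi (J x y)) p by apply: hom_mono Pp => // _ ->; exact: seg_in.
by rewrite PhiU ccset_joinE; apply: (hullU_seg _ _ Pu Pv).
Qed.

(** Since [x'] is off the line of [x] and [y], the two segments meet only in the given point, and
    [Phi] preserves this intersection. *)
Lemma cross_image x y x' y' s s' m : affine_indep x y x' -> 0 < s' ->
  seg_pt x y s = seg_pt x' y' s' ->
  ccset_val (Phi (J x y)) m -> ccset_val (Phi (J x' y')) m -> P (seg_pt x y s) m.
Proof.
move=> ind s'0 e h1 h2; apply: (hom_meet PhiI _ (conj h1 h2)).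
move=> _ [/seg_inv[u _ ->] /seg_inv[v _ e']] /=.
have [||_ _ h3] := ind (v / s' * (1 - s) - (1 - u)) (v / s' * s - u) (1 - v / s').
- by ring.
- apply/rowP => i; move/rowP/(_ i): e; move/rowP/(_ i): e'; rewrite !mxE => e' e.
  transitivity (v / s' * ((1 - s) * x 0 i + s * y 0 i) -
     ((1 - u) * x 0 i + u * y 0 i) + (1 - v / s') * x' 0 i); first by ring.
  by rewrite e e'; field; rewrite gt_eqF.
have vs : v = s'.
  have h : v / s' = 1 by lra.
  by rewrite -[v](divfK (lt0r_neq0 s'0)) h mul1r.
by rewrite e' e vs.
Qed.

(* The direction [o] points upwards and [t x] is the highest point of [P x]. *)
Section Tops.
Variables (t : 'rV[R]_c -> 'rV[R]_c.+1) (o : 'rV[R]_(1 + c.+1)).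
Hypothesis Pt : forall x, P x (t x).
Hypothesis top : forall x p, P x p -> exists s q, [/\ 0 <= s, 0 <= q &
  hvec p = s *: hvec (t x) - q *: o].
Hypothesis ind_t : forall x y a, affine_indep x y a ->
  linear_indep4 (hvec (t x)) (hvec (t y)) (hvec (t a)) o.

Let T x := hvec (t x).

Let convexT x y s : x != y -> 0 < s -> s < 1 -> exists a b d,
  [/\ 0 < a, 0 < b, 0 <= d & T (seg_pt x y s) = a *: T x + b *: T y - d *: o].
Proof.
move=> xy s0 s1; have [u [v [r [Pu Pv /andP[r0 r1] e]]]] :=
  between_image (ltW s0) (ltW s1) (Pt (seg_pt x y s)).
have [a [q [a0 q0 eu]]] := top Pu; have [b [q' [b0 q'0 ev]]] := top Pv.
have eT : T (seg_pt x y s) = ((1 - r) * a) *: T x + (r * b) *: T y -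
    ((1 - r) * q + r * q') *: o.
  rewrite /T e hvec_seg eu ev; apply/rowP => i; rewrite !mxE; ring.
have r10 : 0 <= 1 - r by lra.
have [k xyk] := off_line xy.
exists ((1 - r) * a), (r * b), ((1 - r) * q + r * q'); split=> //.
(* With a zero coefficient the top at the inner point would be a combination of [T y] and [o],
   although that point, [y] and [k] are affinely independent. *)
- rewrite lt_neqAle mulr_ge0// andbT; apply/eqP => a_0.
  have ind : affine_indep (seg_pt x y s) y k.
    by rewrite -[in X in affine_indep _ X _](seg_pt1 x y); apply: affine_indep_seg;
      rewrite // lt_eqF.
  have ind' : linear_indep4 (T _) (T _) (T _) o := ind_t ind.
  have [|/eqP] := ind' 1 (- (r * b)) 0 ((1 - r) * q + r * q').
    rewrite eT -a_0; apply/rowP => i; rewrite !mxE; ring.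
  by rewrite oner_eq0.
- rewrite lt_neqAle mulr_ge0// andbT; apply/eqP => b_0.
  have ind : affine_indep x (seg_pt x y s) k.
    by rewrite -[in X in affine_indep X _ _](seg_pt0 x y); apply: affine_indep_seg;
      rewrite // lt_eqF.
  have ind' : linear_indep4 (T _) (T _) (T _) o := ind_t ind.
  have [|_ /eqP] := ind' (- ((1 - r) * a)) 1 0 ((1 - r) * q + r * q').
    rewrite eT -b_0; apply/rowP => i; rewrite !mxE; ring.
  by rewrite oner_eq0.
- by rewrite addr_ge0// mulr_ge0.
Qed.

(** [T z + d *: o] is the combination [a *: T x + b *: T y], so it lies in the cone over the image
    of the segment; convexity with [T z] itself gives every smaller overshoot [e]. *)
Let slack_cone x y z a b d e : ccset_val (J x y) z ->
  0 < a -> 0 < b -> 0 < d -> 0 < e -> e <= d ->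
  T z = a *: T x + b *: T y - d *: o ->
  exists k m, [/\ 0 < k, ccset_val (Phi (J x y)) m & T z + e *: o = k *: hvec m].
Proof.
move=> Jz a0 b0 d0 e0 ed eT; have Px := @image_joinl x y; have Py := @image_joinr x y.
have Pz : ccset_val (Phi (J x y)) (t z).
  by apply: hom_mono (Pt z) => // _ ->.
have ed0 : 0 < e / d by rewrite divr_gt0.
have ed1 : e / d <= 1 by rewrite ler_pdivrMr// mul1r.
have k0 : 0 <= 1 - e / d by lra.
have [m Pm em] := cone3 (@cvx (J x y)) Pz (Px _ (Pt x)) (Py _ (Pt y)) k0
  (ltW (mulr_gt0 ed0 a0)) (ltW (mulr_gt0 ed0 b0)).
exists (1 - e / d + e / d * a + e / d * b), m; split => //.
  by have := mulr_gt0 ed0 a0; have := mulr_gt0 ed0 b0; lra.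
rewrite -em -/(T z) -/(T x) -/(T y).
move: (T x) (T y) (T z) eT => X Y Z -> {em}; apply/rowP => i; rewrite !mxE.
by field; rewrite gt_eqF.
Qed.

(** The smaller overshoot is available in both cones, so it gives one point of both images. That
    point belongs to the image of the crossing point, yet lies strictly above its top. *)
Let crossT x y x' y' s s' : 0 < s -> s < 1 -> 0 < s' -> s' < 1 ->
  seg_pt x y s = seg_pt x' y' s' -> affine_indep x y x' ->
  slack T o x (seg_pt x y s) y -> slack T o x' (seg_pt x y s) y' -> False.
Proof.
move=> s0 s1 s'0 s'1 e ind [a [b [d [a0 b0 d0 h]]]] [a' [b' [d' [a'0 b'0 d'0 h']]]].
set z := seg_pt x y s in h h' *.
pose f := Num.min d d'.
have f0 : 0 < f by rewrite lt_min d0.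
have Jz : ccset_val (J x y) z by apply: seg_in; exact: ltW.
have Jz' : ccset_val (J x' y') z by rewrite /z e; apply: seg_in; exact: ltW.
have [|k [m [k0 Pm em]]] := slack_cone Jz a0 b0 d0 f0 _ h; first by rewrite ge_min lexx.
have [|k' [m' [k'0 Pm' em']]] := slack_cone Jz' a'0 b'0 d'0 f0 _ h'.
  by rewrite ge_min lexx orbT.
have [_ mm'] : k = k' /\ m = m' by apply: scale_hvec_inj; rewrite ?gt_eqF// -em -em'.
rewrite -mm' in Pm'; have Pzm : P z m := cross_image ind s'0 e Pm Pm'.
have [r [q [r0 q0 er]]] := top Pzm.
have xz : affine_indep x z x'.
  rewrite -[in X in affine_indep X _ _](seg_pt0 x y); apply: affine_indep_seg => //.
  by rewrite lt_eqF.
have xz' : linear_indep4 (T _) (T _) (T _) o := ind_t xz.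
have [|_ _ _] := xz' 0 (1 - k * r) 0 (f + k * q).
  have {}er : hvec m = r *: T z - q *: o := er.
  move: em; rewrite er => /rowP em; apply/rowP => i.
  by have := em i; rewrite !mxE; lra.
have : 0 <= k * q by rewrite mulr_ge0// ltW.
lra.
Qed.

Lemma top_surj x y w : x != y -> 0 <= w -> w <= 1 -> exists s,
  [/\ 0 <= s, s <= 1 & t (seg_pt x y s) = seg_pt (t x) (t y) w].
Proof.
apply: seg_surj off_line _ _ _ _ _ => [x' y' a ind r s q rsq e|x' y' s xy s0 s1].
  have [|-> -> ->] := ind_t ind (r := r) (s := s) (t := q) (q := 0); last by split.
  rewrite scale0r addr0 hvec_lin2 scale_hvec add_row_mx e.
  have -> : const_mx (r + s) + const_mx q = 0 :> 'rV[R]_1.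
    by apply/rowP => i; rewrite !mxE.
  exact: row_mx0.
have [a [b [a0 b0 e]]] := tight off_line ind_t convexT crossT xy s0 s1.
move: e; rewrite /T hvec_lin2 => /eq_row_mx[/rowP/(_ 0)]; rewrite !mxE => ab e.
exists b; split => //; first by lra.
by rewrite e /seg_pt; congr (_ *: _ + _); lra.
Qed.

End Tops.

Lemma hspan_triangle x y a :
  (hspan (Phi (Order.join (ccset1 x) (J y a))) <=
   hspan (P x) + hspan (P y) + hspan (P a))%VS.
Proof.
rewrite !PhiU !ccset_joinE; apply: subv_trans (hspan_hull _) _.
apply: subv_trans (hspanU _ _) _; rewrite -addvA; apply: addvS => //.
exact: subv_trans (hspan_hull _) (hspanU _ _).
Qed.

Lemma rank_sum x y a : affine_indep x y a ->
  (\dim (hspan (P x)) + 2 <= \dim (hspan (P x) + hspan (P y) + hspan (P a)))%N.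
Proof.
move=> ind; apply: leq_trans (dimvS (hspan_triangle x y a)).
exact: rank_triangle.
Qed.

Let rank2 x : (\dim (hspan (P x)) <= 2)%N.
Proof. exact: rank_point. Qed.

(** * The empty set has a nonempty image *)

Section Cone.
Variable o1 : 'rV[R]_c.+1.
Hypothesis Fo1 : F o1.

Let Po1 x : P x o1. Proof. exact: F_sub Fo1. Qed.

Let point_neq x : exists2 p, P x p & p != o1.
Proof.
have [p Pp nF] := nonempty_point PhiI PhiU c_gt0 nontrivial x.
by exists p => //; apply: contra_notN nF => /eqP ->.
Qed.

Let exists_triple (x : 'rV[R]_c) : exists y a, affine_indep x y a.
Proof.
have [|e e0] := @exists_notin _ _ (0 : {vspace 'rV[R]_c})%VS.
  by rewrite dimv0 dimvf /dim /= mul1n.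
have [|a ind] := @off_line x (x + e); last by exists (x + e), a.
by rewrite -subr_eq0 opprD addrA subrr sub0r oppr_eq0 -memv0.
Qed.

(** With two points in [F], all point images would lie on the line through them, against
    [rank_sum]. *)
Let F_o1 p : F p -> p = o1.
Proof.
move=> Fp; apply/eqP; apply: contrapT => /negP po1.
have PF x : hspan (P x) = <<[:: hvec p; hvec o1]>>%VS.
  apply: (span_eq_of_free (free_hvec2 po1)); last exact: rank2.
  move=> z; rewrite !inE => /orP[]/eqP->; apply: hspan_in; [exact: F_sub Fp|exact: Po1].
have [y [a ind]] := exists_triple 0.
by have := rank_sum ind; rewrite !PF !addvv; lia.
Qed.

Let rank_eq2 x : \dim (hspan (P x)) = 2%N.
Proof.
apply/eqP; rewrite eqn_leq rank2 ltnNge; apply/negP => d1.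
have [p Pp] := point_neq x; rewrite -ltnS in d1.
by rewrite (hspan_eq1 d1 Pp (Po1 x)) eqxx.
Qed.

(* If [o1] is interior to the segment [P x], then [Phi (J x y)] contains a half
   disc around [o1]. *)
Let half_disc x y y' u v q q' (s a b g : R) : P x u -> P x v -> o1 = seg_pt u v s ->
  0 < s -> s < 1 -> P y q -> P y' q' -> ~ ccset_val (J x y) y' -> 0 <= g ->
  hvec q' = a *: hvec u + b *: hvec v + g *: hvec q -> q' = o1.
Proof.
move=> Pu Pv eo s0 s1 Pq Pq' nJ g0 e.
have Px := @image_joinl x y; have Py := @image_joinr x y.
pose r := Num.min s (1 - s).
have r0 : 0 < r by rewrite lt_min s0; lra.
have rs : r <= s by rewrite ge_min lexx.
have rs' : r <= 1 - s by rewrite ge_min lexx orbT.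
(* Small enough for [u] and [v] to keep nonnegative coefficients in the point at parameter [m] from
   [o1] to [q']. *)
pose m := r / (1 + `|a| + `|b|).
have D0 : 0 < 1 + `|a| + `|b| by rewrite !ltr_wpDr.
have m0 : 0 < m by rewrite divr_gt0.
have mD : m * (1 + `|a| + `|b|) = r by rewrite divfK// gt_eqF.
have ma : m * - `|a| <= m * a.
  by apply: ler_wpM2l; [exact: ltW|have := ler_norm (- a); rewrite normrN; lra].
have mb : m * - `|b| <= m * b.
  by apply: ler_wpM2l; [exact: ltW|have := ler_norm (- b); rewrite normrN; lra].
have ma0 : 0 <= m * `|a| by rewrite mulr_ge0// ltW.
have mb0 : 0 <= m * `|b| by rewrite mulr_ge0// ltW.
have ms : m * s <= m by rewrite ger_pMr// ltW.
have ms0 : 0 <= m * s by rewrite mulr_ge0// ltW.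
have m1 : m <= 1 by lra.
have h1 : 0 <= (1 - m) * (1 - s) + m * a by lra.
have h2 : 0 <= (1 - m) * s + m * b by lra.
have h3 : 0 <= m * g by rewrite mulr_ge0// ltW.
have [z Jz ez] := cone3 (@cvx (J x y)) (Px _ Pu) (Px _ Pv) (Py _ Pq) h1 h2 h3.
have ez' : hvec (seg_pt o1 q' m) = ((1 - m) * (1 - s) + m * a + ((1 - m) * s + m * b) +
  m * g) *: hvec z.
  rewrite -ez hvec_seg e {1}eo hvec_seg; apply/rowP => i; rewrite !mxE; ring.
have [_ zE] : 1 = (1 - m) * (1 - s) + m * a + ((1 - m) * s + m * b) + m * g /\
  seg_pt o1 q' m = z.
  by apply: scale_hvec_inj; rewrite ?oner_neq0// scale1r.
have : F z.
  apply: (hom_meet PhiI (A := ccset1 y') (B := J x y)).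
    by move=> _ [->].
  by split => //; rewrite -zE; apply: convex_seg => //; exact: ltW.
move=> /F_o1; rewrite -zE => /rowP h; apply/rowP => i; have := h i; rewrite !mxE => hi.
have : m * (q' 0 i - o1 0 i) = 0 by lra.
by move=> /eqP; rewrite mulf_eq0 gt_eqF//= subr_eq0 => /eqP.
Qed.

(** If [o1] were inside the segment [P x] with ends [u] and [v], the line [u v] would cut the plane
    of the image of [x y3] into two sides. By [half_disc] the images of successive points of [x y3]
    have points on opposite sides; three such points cannot all be opposite to each other. *)
Let one_sided x : exists2 p, P x p & forall q, P x q ->
  exists2 s, 0 <= s <= 1 & q = seg_pt o1 p s.
Proof.
have [u [v [Pu Pv uvP]]] := compact_segment (ccset_compact (A := Phi (ccset1 x)))
  (ex_intro _ _ (Po1 x)) (rank2 x).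
have [s /andP[s0 s1] eo] := uvP _ (Po1 x).
move: s0; rewrite le_eqVlt => /orP[/eqP s_0|s0].
  exists v => // q /uvP[r r01 ->]; exists r => //.
  by rewrite eo -s_0 seg_pt0.
move: s1; rewrite le_eqVlt => /orP[/eqP s_1|s1].
  exists u => // q /uvP[r /andP[r0 r1] ->]; exists (1 - r); first by apply/andP; lra.
  by rewrite eo s_1 seg_pt1; apply/rowP => i; rewrite !mxE; ring.
exfalso; have uv : u != v.
  have [p Pp po] := point_neq x; apply: contraNneq po => uv.
  have [r _ ->] := uvP _ Pp; rewrite eo uv; apply/eqP/rowP => i; rewrite !mxE; ring.
have [y3 [y4 ind]] := exists_triple x.
have xy3 := affine_indep_neq ind.
pose y (r : R) := seg_pt x y3 r.
have yJ r r' : 0 <= r -> r < r' -> ~ ccset_val (J x (y r)) (y r').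
  move=> r0 rr' /seg_inv[k /andP[k0 k1] e].
  have : y r' != y (k * r).
    by apply: seg_pt_neq => //; rewrite gt_eqF//; apply: le_lt_trans rr';
      rewrite ler_piMl.
  by rewrite e /y; apply/negP/negPn/eqP/rowP => i; rewrite !mxE; ring.
have Jy r : 0 <= r -> r <= 1 -> P (y r) `<=` Phi (J x y3).
  by move=> r0 r1; apply: hom_mono => // _ ->; exact: seg_in.
have [q1 Pq1 q1o] := point_neq (y 3^-1).
have [q2 Pq2 q2o] := point_neq (y 2^-1).
have [q3 Pq3 q3o] := point_neq (y 1).
have hd := half_disc Pu Pv eo s0 s1.
have fr : free [:: hvec q1; hvec u; hvec v].
  rewrite free_cons free_hvec2// andbT; apply/negP => /mem_span2[a [b e]].
  move/eqP: q1o; apply; apply: (hd x _ u q1 a b 0 Pu Pq1) => //.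
  - have := @yJ 0 3^-1 (lexx 0); rewrite /y seg_pt0; apply; lra.
  - by rewrite scale0r addr0.
have spanE q r : 0 <= r -> r <= 1 -> P (y r) q -> exists g a b,
    hvec q = g *: hvec q1 + a *: hvec u + b *: hvec v.
  move=> r0 r1 Pq; apply: mem_span3.
  rewrite -(span_eq_of_free fr _ (rank_segment PhiI PhiU c_gt0 nontrivial erefl x y3
    c3)).
    by apply: hspan_in; exact: Jy Pq.
  have Px := @image_joinl x y3.
  move=> z; rewrite !inE => /or3P[]/eqP->; apply: hspan_in; [|exact: Px|exact: Px].
  by apply: Jy Pq1; lra.
have neg q r : 3^-1 < r -> r <= 1 -> P (y r) q -> q != o1 -> exists g a b,
    g < 0 /\ hvec q = g *: hvec q1 + a *: hvec u + b *: hvec v.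
  move=> r0 r1 Pq qo; have [|g [a [b e]]] := spanE q r _ r1 Pq; first by lra.
  exists g, a, b; split => //; rewrite ltNge; apply/negP => g0.
  move/eqP: qo; apply; apply: (hd _ _ q1 q a b g Pq1 Pq) => //.
    by apply: yJ => //; lra.
  by rewrite e [RHS]addrC addrA.
have [||g2 [a2 [b2 [g20 e2]]]] := neg q2 2^-1 _ _ Pq2 q2o; [lra|lra|].
have [||g3 [a3 [b3 [g30 e3]]]] := neg q3 1 _ _ Pq3 q3o; [lra|lra|].
move/eqP: q3o; apply; apply: (hd _ _ q2 q3 (a3 - g3 / g2 * a2) (b3 - g3 / g2 * b2)
  (g3 / g2) Pq2 Pq3).
- by apply: yJ; lra.
- by rewrite ltW// -mulrNN -invrN divr_gt0 ?oppr_gt0.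
- by rewrite e2 e3; apply/rowP => i; rewrite !mxE; field; rewrite lt_eqF.
Qed.

Lemma cone_convex : convex_set (\bigcup_(x : 'rV[R]_c) P x).
Proof.
have /choice[p pP] : forall x, exists p, P x p /\
    forall q, P x q -> exists2 s, 0 <= s <= 1 & q = seg_pt o1 p s.
  by move=> x; have [p Pp h] := one_sided x; exists p.
have po x : p x != o1.
  have [q Pq qo] := point_neq x; apply: contraNneq qo => e.
  have [s _ ->] := (pP x).2 q Pq; rewrite e; apply/eqP/rowP => i; rewrite !mxE; ring.
have PE x : hspan (P x) = <<[:: hvec (p x); hvec o1]>>%VS.
  apply: (span_eq_of_free (free_hvec2 (po x))); last exact: rank2.
  by move=> z; rewrite !inE => /orP[]/eqP->; apply: hspan_in; [exact: (pP x).1|exact: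
    Po1].
(* Upwards means away from [o1]: a point [seg_pt o1 p s] is [s] times the top minus [1 - s] times
   [- hvec o1]. *)
have surj := @top_surj p (- hvec o1).
apply: segs_convex => u v s [x _ Pu] [y _ Pv] s0 s1.
have [xy|xy] := eqVneq x y.
  by exists x => //; apply: convex_seg => //; rewrite xy.
have [a /andP[a0 a1] eu] := (pP x).2 u Pu; have [b /andP[b0 b1] ev] := (pP y).2 v Pv.
have A0 : 0 <= (1 - s) * a by rewrite mulr_ge0// subr_ge0.
have A1 : (1 - s) * a <= 1 - s by rewrite ler_piMr// subr_ge0.
have B0 : 0 <= s * b by rewrite mulr_ge0.
have B1 : s * b <= s by rewrite ler_piMr.
have [AB|AB] := eqVneq ((1 - s) * a + s * b) 0.
  exists x => //; have -> : seg_pt u v s = o1; last exact: Po1.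
  have hA : (1 - s) * a = 0 by lra.
  have hB : s * b = 0 by lra.
  transitivity ((1 - s - (1 - s) * a + (s - s * b)) *: o1 + ((1 - s) * a) *:
    p x + (s * b) *: p y).
    by rewrite eu ev; apply/rowP => i; rewrite !mxE; ring.
  by rewrite hA hB; apply/rowP => i; rewrite !mxE; ring.
have AB0 : 0 < (1 - s) * a + s * b by rewrite lt_def AB addr_ge0.
(* The ray from [o1] through the given point of [u v] meets the segment from [p x] to [p y] at this
   parameter. *)
have [|||||r [r0 r1 er]] := surj _ _ _ x y (s * b / ((1 - s) * a + s * b)) xy.
- by move=> z; exact: (pP z).1.
- move=> z q /(pP z).2[r /andP[r0 r1] ->]; exists r, (1 - r); split => //; first by lra.
  by rewrite hvec_seg; apply/rowP => i; rewrite !mxE; ring.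
- move=> k l m ind; apply: linear_indep4P; rewrite -[4%N]/(2 + 2)%N -{1}(rank_eq2 k).
  apply: leq_trans (rank_sum ind) (dimvS _); rewrite !PE !subv_add.
  have oS : hvec o1 \in <<[:: hvec (p k); hvec (p l); hvec (p m); - hvec o1]>>%VS.
    by rewrite -memvN; apply: memv_span; rewrite !inE eqxx !orbT.
  rewrite -!andbA; apply/and3P; split; apply/span_subvP => z;
    rewrite !inE => /orP[]/eqP-> //; by apply: memv_span; rewrite !inE eqxx ?orbT.
- by rewrite divr_ge0// ltW.
- by rewrite ler_pdivrMr// mul1r lerDr.
exists (seg_pt x y r) => //.
have -> : seg_pt u v s = seg_pt o1 (p (seg_pt x y r)) ((1 - s) * a + s * b).
  by rewrite er eu ev; apply/rowP => i; rewrite !mxE; field.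
apply: convex_seg; [exact: ccset_convex|exact: Po1|exact: (pP _).1|exact: ltW|lra].
Qed.

End Cone.

(** * The empty set has an empty image: point images are disjoint *)

Section Disjoint.
Hypothesis F0 : forall p, ~ F p.

Let disj x y p : P x p -> P y p -> x = y.
Proof.
by move=> Px Py; apply/eqP; apply: contrapT => /negP xy; apply:
  F0 (point_disjoint xy Px Py).
Qed.

Let point_ex x : exists p, P x p.
Proof. by have [p Pp _] := nonempty_point PhiI PhiU c_gt0 nontrivial x; exists p. Qed.

Let strict_between x y s p : x != y -> 0 < s -> s < 1 -> P (seg_pt x y s) p ->
  exists u v r, [/\ P x u, P y v, 0 < r < 1 & p = seg_pt u v r].
Proof.
move=> xy s0 s1 Pp; have [u [v [r [Pu Pv /andP[r0 r1] e]]]] :=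
  between_image (ltW s0) (ltW s1) Pp.
exists u, v, r; split => //; rewrite !lt_neqAle r0 r1 !andbT; apply/andP; split;
  apply/eqP => re.
- have : x = seg_pt x y s by apply: disj Pu _; rewrite e -re seg_pt0 in Pp.
  by rewrite -{1}(seg_pt0 x y); apply/eqP; rewrite seg_pt_neq// lt_eqF.
- have : y = seg_pt x y s by apply: disj Pv _; rewrite e re seg_pt1 in Pp.
  by rewrite -{1}(seg_pt1 x y); apply/eqP; rewrite seg_pt_neq// gt_eqF.
Qed.

Local Notation N x := (\dim (hspan (P x)) == 2%N).

Let notN x p q : ~~ N x -> P x p -> P x q -> p = q.
Proof. by move=> Nx; apply: hspan_eq1; rewrite ltn_neqAle Nx rank2. Qed.

Let yesN x p : N x -> P x p -> exists2 q, P x q & p != q.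
Proof.
move=> Nx Pp; apply: contrapT => h; have : hspan (P x) = <<[:: hvec p]>>%VS.
  apply/eqP; rewrite eqEsubv; apply/andP; split.
    apply: hspan_sub => q Pq; have -> : q = p.
      by apply/eqP; apply: contrapT => /negP qp; apply: h; exists q; rewrite // eq_sym.
    by rewrite memv_span// mem_head.
  by apply/span_subvP => z; rewrite inE => /eqP ->; exact: hspan_in.
by move=> e; move: Nx; rewrite e span_seq1 dim_vline hvec_neq0.
Qed.

Lemma single_convex : (forall x, ~~ N x) -> convex_set (\bigcup_(x : 'rV[R]_c) P x).
Proof.
move=> nN; have /choice[p pP] := point_ex.
apply: segs_convex => u v s [x _ Pu] [y _ Pv] s0 s1.
have [xy|xy] := eqVneq x y.
  by exists x => //; apply: convex_seg => //; rewrite xy.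
have [||r [_ _ er]] := @seg_surj _ _ _ p off_line _ _ x y s xy s0 s1.
- move=> k l m ind r t q rtq e; have fr : free [:: hvec (p k); hvec (p l); hvec (p m)].
    rewrite /free eqn_leq dim_span /=; apply: leq_trans (_ :
      \dim (hspan (P k)) + 2 <= _)%N.
      by rewrite -addn1 addnC leq_add2r; exact: hspan_gt0 (pP k).
    apply: leq_trans (rank_sum ind) (dimvS _); rewrite !subv_add -!andbA.
    by apply/and3P; split; apply: hspan_sub => z Pz; apply: memv_span;
      rewrite !inE (notN (nN _) Pz (pP _)) eqxx ?orbT.
  apply: (free3P fr); rewrite hvec_lin2 scale_hvec add_row_mx e -row_mx0; congr row_mx.
  by apply/rowP => i; rewrite !mxE.
- move=> k l r kl r0 r1; have [u' [v' [q [Pu' Pv' /andP[q0 q1] e]]]] :=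
  strict_between kl r0 r1 (pP _).
  by exists q; split => //; rewrite e (notN (nN _) Pu' (pP _)) (notN (nN _) Pv' (pP _)).
exists (seg_pt x y r) => //.
by rewrite (notN (nN _) Pu (pP _)) (notN (nN _) Pv (pP _)) -er.
Qed.

(** Otherwise, for [a] off the line of [x] and [y], the images of [x] and [a] alone would span rank
    four by [rank_sum], while the image of a segment has rank at most three. *)
Let span_not_sub x y : N x -> x != y -> ~ (hspan (P y) <= hspan (P x))%VS.
Proof.
move=> Nx xy sub; have [a ind] := off_line xy.
have h1 := rank_sum ind; rewrite (addv_idPl sub) in h1.
have h2 := rank_segment PhiI PhiU c_gt0 nontrivial erefl x a c3.
have Px := @image_joinl x a; have Pa := @image_joinr x a.
have : (hspan (P x) + hspan (P a) <= hspan (Phi (J x a)))%VS.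
  by rewrite subv_add !hspanS.
by move=> /dimvS; rewrite (eqP Nx) in h1; lia.
Qed.

(** When [P x] and [P y] are single points, two points of [P z] determine the line through them, so
    [P y] lies in the span of [P z], against [span_not_sub]. *)
Let notN_convex x y s : ~~ N x -> ~~ N y -> 0 <= s -> s <= 1 -> ~~ N (seg_pt x y s).
Proof.
move=> Nx Ny s0 s1; have [<-|xy] := eqVneq x y.
  by have -> : seg_pt x x s = x; [apply/rowP => i; rewrite !mxE; ring|].
move: s0; rewrite le_eqVlt => /orP[/eqP<-|s0]; first by rewrite seg_pt0.
move: s1; rewrite le_eqVlt => /orP[/eqP->|s1]; first by rewrite seg_pt1.
apply/negP => Nz; set z := seg_pt x y s in Nz.
have zy : z != y by rewrite -[X in _ != X](seg_pt1 x) seg_pt_neq// lt_eqF.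
have [p Pp] := point_ex z; have [q Pq pq] := yesN Nz Pp.
have [u [v [r [Pu Pv _ ep]]]] := strict_between xy s0 s1 Pp.
have [u' [v' [r' [Pu' Pv' _ eq]]]] := strict_between xy s0 s1 Pq.
rewrite -(notN Nx Pu Pu') -(notN Ny Pv Pv') in eq.
apply: (span_not_sub Nz zy); apply: hspan_sub => w Pw.
have rr' : r - r' != 0.
  by apply: contraNneq pq => h; rewrite ep eq; have -> : r = r'; [lra|].
have -> : w = seg_pt p q ((r - 1) / (r - r')).
  by rewrite (notN Ny Pw Pv) ep eq; apply/rowP => i; rewrite !mxE; field.
by rewrite hvec_seg memvD// memvZ// hspan_in.
Qed.

Let N_reflect x e : N x -> N (x + e) \/ N (x - e).
Proof.
move=> Nx; have [|n1] := boolP (N (x + e)); first by left.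
have [|n2] := boolP (N (x - e)); first by right.
have half0 : 0 <= 2^-1 :> R by lra.
have half1 : 2^-1 <= 1 :> R by lra.
have := notN_convex n1 n2 half0 half1.
have -> : seg_pt (x + e) (x - e) 2^-1 = x by apply/rowP => i; rewrite !mxE; field.
by rewrite Nx.
Qed.

Let N_triple x : N x -> exists y a, [/\ N y, N a & affine_indep x y a].
Proof.
move=> Nx; have [e e0] : exists e : 'rV[R]_c, e != 0.
  have [|e] := @exists_notin _ _ (0 : {vspace 'rV[R]_c})%VS.
    by rewrite dimv0 dimvf /dim /= mul1n.
  by rewrite memv0; exists e.
have [y [Ny xy]] : exists y, N y /\ x != y.
  have [Ny|Ny] := N_reflect e Nx.
    by exists (x + e); split => //; rewrite -subr_eq0 opprD addrA subrr sub0r oppr_eq0.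
  by exists (x - e); split => //; rewrite -subr_eq0 opprB addrCA subrr addr0.
have [a ind] := off_line xy; exists y.
have [Na|Na] := N_reflect (a - x) Nx.
  by exists a; split => //; move: Na; rewrite addrC subrK.
exists (x - (a - x)); split => // r s t rst e1.
have [||h1 h2 h3] := ind (r + 2 * t) s (- t).
- by rewrite -rst; ring.
- by rewrite -e1; apply/rowP => i; rewrite !mxE; ring.
by split; lra.
Qed.

(** Both lines lie in the plane of the image of the segment, so they meet projectively:
    [2 + 2 - 3]. *)
Let meet_line_ge1 x y : N x -> N y -> (1 <= \dim (hspan (P x) :&: hspan (P y)))%N.
Proof.
move=> Nx Ny; have := rank_segment PhiI PhiU c_gt0 nontrivial erefl x y c3.
have Px := @image_joinl x y; have Py := @image_joinr x y.
have : (hspan (P x) + hspan (P y) <= hspan (Phi (J x y)))%VS by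
  rewrite subv_add !hspanS.
move=> /dimvS; have := dimv_sum_cap (hspan (P x)) (hspan (P y)).
by rewrite (eqP Nx) (eqP Ny); lia.
Qed.

Let meet_line_le1 x y : N x -> N y -> x != y -> (\dim (hspan (P x) :&:
  hspan (P y)) <= 1)%N.
Proof.
move=> Nx Ny xy; rewrite leqNgt; apply/negP => h; apply: (span_not_sub Nx xy).
apply/capv_idPr/eqP; rewrite eqEdim capvSr; apply: leq_trans h.
by rewrite (eqP Ny).
Qed.

(* Three pairwise coplanar lines not in a common plane are concurrent or
   parallel. *)
Let concurrent x y a : N x -> N y -> N a -> affine_indep x y a ->
  (hspan (P x) :&: hspan (P y) <= hspan (P a))%VS.
Proof.
move=> Nx Ny Na ind; set X := hspan (P x); set Y := hspan (P y); set A := hspan (P a).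
have xy := affine_indep_neq ind.
have dX : \dim X = 2%N by exact/eqP.
have dY : \dim Y = 2%N by exact/eqP.
have dA : \dim A = 2%N by exact/eqP.
have dXY : \dim (X :&: Y) = 1%N.
  by apply/eqP; rewrite eqn_leq meet_line_le1// meet_line_ge1.
have s1 := dimv_sum_cap X Y; have s2 := dimv_sum_cap (X + Y) A.
have h := rank_sum ind; rewrite -/X -/Y -/A in h.
have dT : (\dim ((X + Y) :&: A) <= 1)%N by lia.
have XA : (X :&: A == (X + Y) :&: A)%VS.
  rewrite eqEdim capvS ?addvSl//; apply: leq_trans dT _; exact: meet_line_ge1.
have YA : (Y :&: A == (X + Y) :&: A)%VS.
  rewrite eqEdim capvS ?addvSr//; apply: leq_trans dT _; exact: meet_line_ge1.
have sub : (X :&: A <= X :&: Y)%VS.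
  by rewrite subv_cap capvSl (eqP XA) -(eqP YA) capvSl.
have /eqP <- : (X :&: A == X :&: Y)%VS.
  by rewrite eqEdim sub dXY meet_line_ge1.
exact: capvSr.
Qed.

(** A point [b] on the line of [x] and [y] is out of reach of [concurrent] for that pair; the pair
    [x], [a] replaces it. *)
Lemma center_ex x : N x -> exists2 o, o != 0 & forall b, N b -> o \in hspan (P b).
Proof.
move=> Nx; have [y [a [Ny Na ind]]] := N_triple Nx.
have xy := affine_indep_neq ind.
have xa := affine_indep_neq (affine_indepA (affine_indepA (affine_indepC ind))).
pose o := vpick (hspan (P x) :&: hspan (P y)).
have o_in : o \in (hspan (P x) :&: hspan (P y))%VS by exact: memv_pick.
have ox : o \in hspan (P x) := subvP (capvSl _ _) _ o_in.
exists o.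
  by rewrite vpick0 -dimv_eq0 -lt0n meet_line_ge1.
move=> b Nb; have [indb|[s bE]] := affine_indep_dec b xy.
  exact: subvP (concurrent Nx Ny Nb indb) _ o_in.
have oa : o \in hspan (P a) := subvP (concurrent Nx Ny Na ind) _ o_in.
have [->//|bx] := eqVneq b x.
have s0 : 0 != s by apply: contraNneq bx => s0; rewrite bE -s0 seg_pt0.
have := affine_indep_seg s0 ind; rewrite seg_pt0 -bE => ind'.
have indab : affine_indep x a b := affine_indepC (affine_indepA (affine_indepA ind')).
by apply: subvP (concurrent Nx Na Nb indab) _ _; rewrite memv_cap ox oa.
Qed.

(** * Point images on lines through a common center *)

Section Center.
Variables (n0 : 'rV[R]_c) (o : 'rV[R]_(1 + c.+1)).
Hypothesis Nn0 : N n0.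
Hypothesis o0 : o != 0.
Hypothesis oN : forall b, N b -> o \in hspan (P b).

(** Suppose [p] is the center. Reflect some [n] of [N] in [x] to get [y]: then [p] lies strictly
    between points of [P n] and [P y]. Since [p] is on the line of [P n], so is the point [v] of
    [P y], and the span of [P y] falls into that of [P n]. *)
Let o_off x p k : P x p -> o != k *: hvec p.
Proof.
move=> Pp; apply/eqP => eo.
have k0 : k != 0 by apply: contraNneq o0 => k0; rewrite eo k0 scale0r.
have [n [Nn nx]] : exists n, N n /\ n != x.
  have [y [a [Ny _ ind]]] := N_triple Nn0.
  have [n0x|] := eqVneq n0 x; last by exists n0.
  by exists y; split => //; rewrite eq_sym -n0x; exact: affine_indep_neq ind.
pose y := 2 *: x - n.
have ny : n != y.
  apply: contraNneq nx => /rowP e; apply/eqP/rowP => i.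
  by have := e i; rewrite !mxE; lra.
have xE : x = seg_pt n y 2^-1 by apply/rowP => i; rewrite !mxE; field.
have half0 : 0 < 2^-1 :> R by lra.
have half1 : 2^-1 < 1 :> R by lra.
rewrite xE in Pp; have [u [v [r [Pu Pv /andP[r0 r1] ep]]]] :=
  strict_between ny half0 half1 Pp.
have pn : hvec p \in hspan (P n).
  by rewrite -[hvec p](scalerK k0) -eo memvZ// oN.
have vn : hvec v \in hspan (P n).
  rewrite -[hvec v](scalerK (lt0r_neq0 r0)) memvZ//.
  have -> : r *: hvec v = hvec p - (1 - r) *: hvec u.
    by rewrite ep hvec_seg; apply/rowP => i; rewrite !mxE; ring.
  by rewrite memvB// memvZ// hspan_in.
apply: (span_not_sub Nn ny); have [Ny|nNy] := boolP (N y); last first.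
  by apply: hspan_sub => q Pq; rewrite (notN nNy Pq Pv).
have pv : p != v.
  apply/eqP => pv; rewrite pv in Pp; have := disj Pp Pv; rewrite -xE => xy.
  by move/eqP: nx; apply; apply/rowP => i; have /rowP/(_ i) := xy; rewrite !mxE; lra.
have py : hvec p \in hspan (P y).
  by rewrite -[hvec p](scalerK k0) -eo memvZ// oN.
rewrite (span_eq_of_free (free_hvec2 pv) _ (rank2 y)).
  by apply/span_subvP => z; rewrite !inE => /orP[]/eqP->.
by move=> z; rewrite !inE => /orP[]/eqP-> //; exact: hspan_in.
Qed.

Let free_o x p : P x p -> free [:: hvec p; o].
Proof.
move=> Pp; rewrite free_cons seq1_free o0 andbT span_seq1; apply/vlineP => -[k ek].
have k0 : k != 0.
  by apply: contraNneq (hvec_neq0 p) => k0; rewrite ek k0 scale0r.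
by have := o_off k^-1 Pp; rewrite ek scalerA mulVf// scale1r eqxx.
Qed.

Let line_span x p : N x -> P x p -> hspan (P x) = <<[:: hvec p; o]>>%VS.
Proof.
move=> Nx Pp; apply: (span_eq_of_free (free_o Pp)); last exact: rank2.
by move=> z; rewrite !inE => /orP[]/eqP->; rewrite ?hspan_in ?oN.
Qed.

Let coef_o x p a b : P x p -> a *: hvec p + b *: o = 0 -> a = 0 /\ b = 0.
Proof.
move=> Pp /(free_cons_eq0 (free_o Pp))[|-> /eqP].
  by rewrite memvZ// memv_span// mem_head.
by rewrite scaler_eq0 (negPf o0) orbF => /eqP.
Qed.

(** Shifting some weight from [u] to another point [q] of [P y] moves [p] along [o] without leaving
    the image of the segment. *)
Let up_or_down x y z p s : N y -> y != z -> 0 < s -> s < 1 -> x = seg_pt y z s ->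
  P x p ->
  exists b, b != 0 /\ exists k m, [/\ 0 < k, ccset_val (Phi (J y z)) m &
    hvec p + b *: o = k *: hvec m].
Proof.
move=> Ny yz s0 s1 xE; rewrite xE => Pp.
have [u [v [r [Pu Pv /andP[r0 r1] ep]]]] := strict_between yz s0 s1 Pp.
have [q Pq uq] := yesN Ny Pu.
have := hspan_in Pq; rewrite (line_span Ny Pu) => /mem_span2[a [b eq]].
have b0 : b != 0.
  apply: contraNneq uq => b0; move: eq; rewrite b0 scale0r addr0 -[LHS]scale1r.
  by move=> /(scale_hvec_inj (oner_neq0 _))[_ ->].
pose h := (1 - r) / (1 + `|a|).
have D0 : 0 < 1 + `|a| by rewrite ltr_wpDr.
have h0 : 0 < h by rewrite divr_gt0// subr_gt0.
have hD : h * (1 + `|a|) = 1 - r by rewrite divfK// gt_eqF.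
have ha : h * a <= h * `|a| by rewrite ler_wpM2l ?ler_norm// ltW.
have Py := @image_joinl y z; have Pz := @image_joinr y z.
have c1 : 0 <= 1 - r - h * a by lra.
have [m Jm em] := cone3 (@cvx (J y z)) (Py _ Pu) (Py _ Pq) (Pz _ Pv) c1 (ltW h0) (ltW
  r0).
exists (h * b); split; first by rewrite mulf_neq0// gt_eqF.
exists (1 - r - h * a + h + r), m; split => //; first by lra.
by rewrite -em eq ep hvec_seg; apply/rowP => i; rewrite !mxE; ring.
Qed.

(** Scaled down to a common size [f], the two overshoots give one point of both images, hence of
    [P x], which contains only [p]. *)
Let same_side x y z y' z' p s s' b b' k k' m m' : ~~ N x -> P x p ->
  affine_indep y z y' -> 0 < s -> s < 1 -> 0 < s' -> s' < 1 ->
  x = seg_pt y z s -> x = seg_pt y' z' s' ->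
  ccset_val (Phi (J y z)) m -> ccset_val (Phi (J y' z')) m' -> 0 < k -> 0 < k' ->
  hvec p + b *: o = k *: hvec m -> hvec p + b' *: o = k' *: hvec m' ->
  0 < b * b' -> False.
Proof.
move=> nNx Pp ind s0 s1 s'0 s'1 xE xE' Jm Jm' k0 k'0 e e' bb'.
have PJ (y1 z1 : 'rV[R]_c) r : 0 < r -> r < 1 -> x = seg_pt y1 z1 r ->
  ccset_val (Phi (J y1 z1)) p.
  by move=> r0 r1 xE1; apply: hom_mono Pp => // _ ->; rewrite xE1; apply: seg_in; exact:
    ltW.
have comb (C : ccset R c) (t d k1 : R) m1 : 0 <= t -> t <= 1 -> 0 < k1 ->
  ccset_val (Phi C) p ->
    ccset_val (Phi C) m1 -> hvec p + d *: o = k1 *: hvec m1 ->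
    exists2 w, ccset_val (Phi C) w & exists2 l, 0 < l & hvec p + (t * d) *: o = l *:
      hvec w.
  move=> t0 t1 k10 Cp Cm e1.
  have t10 : 0 <= 1 - t by lra.
  have [w Cw ew] := cone2 (@cvx C) Cp Cm t10 (mulr_ge0 t0 (ltW k10)).
  exists w => //; exists (1 - t + t * k1).
    move: t0; rewrite le_eqVlt => /orP[/eqP<-|t0]; first by lra.
    by have := mulr_gt0 t0 k10; lra.
  by rewrite -ew -[(t * k1) *: _]scalerA -e1; apply/rowP => i; rewrite !mxE; ring.
have b0 : b != 0 by apply: contraTneq bb' => ->; rewrite mul0r ltxx.
have b'0 : b' != 0 by apply: contraTneq bb' => ->; rewrite mulr0 ltxx.
have [f [t [t' [f0 /andP[t0 t1] /andP[t'0 t'1] etb etb']]]] : exists f t t', [/\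
  f != 0, 0 <= t <= 1,
    0 <= t' <= 1, t * b = f & t' * b' = f].
  have D0 : 0 < `|b| + `|b'| by rewrite addr_gt0// normr_gt0.
  have e1 : `|b| * b' = `|b'| * b.
    have [b_gt0|b_le0] := ltP 0 b.
      by move: bb'; rewrite pmulr_rgt0// => b'_gt0; rewrite !gtr0_norm// mulrC.
    have b_lt0 : b < 0 by rewrite lt_neqAle b0.
    by move: bb'; rewrite nmulr_rgt0// => b'_lt0; rewrite !ltr0_norm// !mulNr mulrC.
  exists (`|b| * b' / (`|b| + `|b'|)), (`|b'| / (`|b| + `|b'|)), (`|b| / (`|b| +
    `|b'|)).
  split.
  - by rewrite !mulf_neq0 ?normr_eq0 ?invr_neq0// gt_eqF.
  - apply/andP; split; first by apply: divr_ge0 => //; exact: ltW.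
    by rewrite ler_pdivrMr// mul1r lerDr.
  - apply/andP; split; first by apply: divr_ge0 => //; exact: ltW.
    by rewrite ler_pdivrMr// mul1r lerDl.
  - by rewrite e1; ring.
  - by ring.
have [w Cw [l l0 ew]] := comb _ _ _ _ _ t0 t1 k0 (PJ _ _ _ s0 s1 xE) Jm e.
have [w' Cw' [l' l'0 ew']] := comb _ _ _ _ _ t'0 t'1 k'0 (PJ _ _ _ s'0 s'1 xE') Jm' e'.
have [_ ww'] : l = l' /\ w = w'.
  by apply: scale_hvec_inj; rewrite ?gt_eqF// -ew -ew' etb etb'.
rewrite -ww' in Cw'; have Pw : P x w.
  by rewrite xE; exact: (cross_image ind s'0 (etrans (esym xE) xE') Cw Cw').
move: ew; rewrite (notN nNx Pw Pp) etb => ew.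
have [_ /eqP] : 1 - l = 0 /\ f = 0.
  by apply: (coef_o Pp); rewrite scalerBl scale1r addrAC ew subrr.
by rewrite (negPf f0).
Qed.

(* Through a point with one-point image, each line meeting [N] has an image
   overshooting that image either upwards or downwards, and two such lines
   cannot overshoot on the same side. *)
Let allN x : N x.
Proof.
apply: contrapT => /negP nNx.
have n0x : x != n0 by apply: contraNneq nNx => ->.
have [a ind] := off_line n0x; have [p Pp] := point_ex x.
(* The points [y t] form a line through [y 0], and [n0] is the midpoint of [x] and [y 0]; [z t] is
   [y t] reflected in [x]. *)
pose y (t : R) := x + 2 *: (n0 - x) + (2 * t) *: (a - x).
pose z (t : R) := 2 *: x - y t.
have yz_ind t u : t != u -> affine_indep (y t) (z t) (y u).
  move=> tu r s q rsq e.
  have [||_ h1 h2] := ind (- (2 * (r - s + q)) - 2 * ((r - s) * t + q * u))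
    (2 * (r - s + q)) (2 * ((r - s) * t + q * u)).
  - by ring.
  - rewrite -e -[LHS]addr0 -[X in _ + X](scale0r x) -rsq.
    by apply/rowP => i; rewrite !mxE; ring.
  have s0 : s = 0 by lra.
  have rq : r = - q by lra.
  have /eqP : q * (u - t) = 0 by move: h2; rewrite s0 rq; lra.
  rewrite mulf_eq0 subr_eq0 [u == t]eq_sym (negPf tu) orbF => /eqP q0.
  by rewrite s0 rq q0 oppr0.
have half0 : 0 < 2^-1 :> R by lra.
have half1 : 2^-1 < 1 :> R by lra.
have xE t : x = seg_pt (y t) (z t) 2^-1 by apply/rowP => i; rewrite !mxE; field.
have side t : N (y t) -> exists b, b != 0 /\ exists k m,
    [/\ 0 < k, ccset_val (Phi (J (y t) (z t))) m & hvec p + b *: o = k *: hvec m].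
  move=> Nt; apply: (up_or_down Nt _ half0 half1 (xE t) Pp).
  by apply: affine_indep_neq (yz_ind t (t + 1) _); rewrite lt_eqF// ltrDl.
(* Of three nonzero overshoots two have the same sign. *)
have three t u v : t != u -> t != v -> u != v -> N (y t) -> N (y u) -> N (y v) -> False.
  move=> tu tv uv /side[b [b0 [k [m [k0 Jm e]]]]] /side[b' [b'0 [k' [m' [k'0 Jm'
    e']]]]].
  move=> /side[b2 [b20 [k2 [m2 [k20 Jm2 e2]]]]].
  have same t' u' (h : t' != u') := same_side nNx Pp (yz_ind t' u' h) half0 half1 half0
    half1 (xE t') (xE u').
  have [bb'|bb'] := ltP 0 (b * b'); first exact: (same _ _ _ _ _ _ t u tu Jm Jm' k0 k'0
    e e' bb').
  have [bb2|bb2] := ltP 0 (b * b2); first exact: (same _ _ _ _ _ _ t v tv Jm Jm2 k0 k20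
    e e2 bb2).
  apply: (same _ _ _ _ _ _ u v uv Jm' Jm2 k'0 k20 e' e2).
  have bb : 0 < b ^+ 2 by rewrite exprn_even_gt0.
  have h : 0 <= (b * b') * (b * b2) by rewrite mulr_le0.
  rewrite lt_def mulf_neq0//= -(pmulr_rge0 _ bb); apply: le_trans h _.
  by rewrite le_eqVlt; apply/orP; left; apply/eqP; ring.
(* At most two [y t] belong to [N], so there are points outside [N] on either side of [y 0].
   Together with [x] they enclose [n0], against [notN_convex]. *)
have one_not (f : R -> R) : injective f -> exists t, [/\ 0 < t & ~~ N (y (f t))].
  move=> finj; apply: contrapT => h.
  have h' t : 0 < t -> N (y (f t)).
    by move=> t0; apply: contrapT => /negP nN; apply: h; exists t.
  apply: (three (f 1) (f 2) (f 3)); try (apply/eqP => /finj; lra); apply: h'; lra.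
have [t [t0 Nt]] := one_not id (fun _ _ e => e).
have [u [u0 Nu]] := one_not -%R oppr_inj.
have tu0 : 0 < t + u by rewrite addr_gt0.
have [||] := negP (notN_convex nNx (notN_convex Nt Nu (s :=
  t / (t + u)) _ _) (ltW half0) (ltW half1)).
- by apply: divr_ge0; exact: ltW.
- by rewrite ler_pdivrMr// mul1r lerDl ltW.
suff -> : seg_pt x (seg_pt (y t) (y (- u)) (t / (t + u))) 2^-1 = n0 by [].
by apply/rowP => i; rewrite !mxE; field; rewrite gt_eqF.
Qed.

(** Otherwise the segment from [u] to [v] would pass through the center, excluded by [o_off]. *)
Let coef_gt0 x u v a b : P x u -> P x v -> hvec v = a *: hvec u + b *: o -> 0 < a.
Proof.
move=> Pu Pv e; rewrite ltNge; apply/negP => a0.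
have a0' : 0 <= - a by rewrite oppr_ge0.
have [m Pm em] := cone2 (@cvx (ccset1 x)) Pv Pu ler01 a0'.
have em' : b *: o = (1 - a) *: hvec m.
  by rewrite -em e; apply/rowP => i; rewrite !mxE; ring.
have b0 : b != 0.
  apply: contraTneq a0 => b0; move/eqP: em'; rewrite b0 scale0r eq_sym scaler_eq0.
  by rewrite (negPf (hvec_neq0 m)) orbF => /eqP h; rewrite -ltNge; lra.
by have := o_off (b^-1 * (1 - a)) Pm; rewrite -scalerA -em' scalerK// eqxx.
Qed.

Let is_top x t o' := forall p, P x p -> exists s q, [/\ 0 <= s, 0 <= q &
  hvec p = s *: hvec t - q *: o'].

Let oriented x u v a b : P x u -> P x v ->
  (forall p, P x p -> exists2 r, 0 <= r <= 1 & p = seg_pt u v r) ->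
  hvec v = a *: hvec u + b *: o -> 0 <= b -> is_top x v o /\ is_top x u (- o).
Proof.
move=> Pu Pv uvP e b0; have a0 := coef_gt0 Pu Pv e.
split=> p /uvP[r /andP[r0 r1] ->]; have r10 : 0 <= 1 - r by lra.
- exists ((1 - r) / a + r), ((1 - r) / a * b).
  split; [by rewrite addr_ge0// divr_ge0// ltW|by rewrite mulr_ge0// divr_ge0// ltW|].
  by rewrite hvec_seg e; apply/rowP => i; rewrite !mxE; field; rewrite gt_eqF.
- exists ((1 - r) + r * a), (r * b).
  split; [by rewrite addr_ge0// mulr_ge0// ltW|by rewrite mulr_ge0|].
  by rewrite hvec_seg e; apply/rowP => i; rewrite !mxE; ring.
Qed.

Let endpoints x : exists tb : 'rV[R]_c.+1 * 'rV[R]_c.+1,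
  [/\ P x tb.1, P x tb.2, is_top x tb.1 o & is_top x tb.2 (- o)].
Proof.
have [p0 Pp0] := point_ex x.
have [u [v [Pu Pv uvP]]] := compact_segment (ccset_compact (A := Phi (ccset1 x)))
  (ex_intro _ _ Pp0) (rank2 x).
have := hspan_in Pv; rewrite (line_span (allN x) Pu) => /mem_span2[a [b e]].
have a0 := coef_gt0 Pu Pv e.
have [b0|b0] := leP 0 b.
  by exists (v, u); have [] := oriented Pu Pv uvP e b0.
exists (u, v); have [|||] := @oriented x v u a^-1 (- b / a) Pv Pu.
- move=> p /uvP[r /andP[r0 r1] ->]; exists (1 - r); first by apply/andP; lra.
  by apply/rowP => i; rewrite !mxE; ring.
- by rewrite e; apply/rowP => i; rewrite !mxE; field; rewrite gt_eqF.
- by rewrite divr_ge0 ?ltW// oppr_gt0.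
- by [].
Qed.

Let indep_tops (t : 'rV[R]_c -> 'rV[R]_c.+1) x y a : (forall x, P x (t x)) ->
  affine_indep x y a -> linear_indep4 (hvec (t x)) (hvec (t y)) (hvec (t a)) o.
Proof.
move=> Pt ind; apply: linear_indep4P; rewrite -[4%N]/(2 + 2)%N -{1}(eqP (allN x)).
apply: leq_trans (rank_sum ind) (dimvS _); rewrite !subv_add -!andbA.
rewrite !(line_span (allN _) (Pt _)).
by apply/and3P; split; apply/span_subvP => z; rewrite !inE => /orP[]/eqP->;
  apply: memv_span; rewrite !inE eqxx ?orbT.
Qed.

Lemma center_convex : convex_set (\bigcup_(x : 'rV[R]_c) P x).
Proof.
have /choice[tb tbP] := endpoints.
pose t x := (tb x).1; pose b x := (tb x).2.
have Pt x : P x (t x) by case: (tbP x).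
have Pb x : P x (b x) by case: (tbP x).
have tT x : is_top x (t x) o by case: (tbP x).
have bT x : is_top x (b x) (- o) by case: (tbP x).
have indb x y a : affine_indep x y a ->
    linear_indep4 (hvec (b x)) (hvec (b y)) (hvec (b a)) (- o).
  move=> /(indep_tops Pb) h r s q k e; have [|-> -> -> +] := h r s q (- k).
  - by rewrite scaleNr -scalerN.
  - by move=> /eqP; rewrite oppr_eq0 => /eqP.
have surj_t := top_surj Pt tT (fun x y a => @indep_tops t x y a Pt).
have surj_b := top_surj Pb bT indb.
apply: segs_convex => u v r [x _ Pu] [y _ Pv] r0 r1.
have [xy|xy] := eqVneq x y.
  by exists x => //; apply: convex_seg => //; rewrite xy.
have r10 : 0 <= 1 - r by lra.
(* The point of [u, v] lies below the top of one [P z] (with [f] the tops) and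
   above the bottom of another (with [f] the bottoms). *)
have reach f o' : (forall x, P x (f x)) -> (forall x, is_top x (f x) o') ->
  (forall w, 0 <= w -> w <= 1 -> exists s,
    [/\ 0 <= s, s <= 1 & f (seg_pt x y s) = seg_pt (f x) (f y) w]) ->
  (forall x p a k, P x p -> a *: hvec p + k *: o' = 0 -> a = 0 /\ k = 0) ->
  exists z, exists2 q, 0 <= q & exists2 e, 0 < e & hvec (seg_pt u v r) = e *:
    hvec (f z) - q *: o'.
  move=> Pf fT surj coef; have [s [q [s0 q0 eu]]] := fT _ _ Pu.
  have [s' [q' [s'0 q'0 ev]]] := fT _ _ Pv.
  have gt0 z p s1 q1 : P z p -> 0 <= s1 -> hvec p = s1 *: hvec (f z) - q1 *: o' ->
    0 < s1.
    move=> Pp s10 e; rewrite lt_neqAle s10 andbT; apply/eqP => s1_0.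
    have [|/eqP + _] := coef z p 1 q1 Pp; last by rewrite oner_eq0.
    by rewrite e -s1_0; apply/rowP => i; rewrite !mxE; ring.
  have s_gt0 := gt0 _ _ _ _ Pu s0 eu; have s'_gt0 := gt0 _ _ _ _ Pv s'0 ev.
  have A0 : 0 <= (1 - r) * s by rewrite mulr_ge0.
  have B0 : 0 <= r * s' by rewrite mulr_ge0.
  have AB : 0 < (1 - r) * s + r * s'.
    move: r0; rewrite le_eqVlt => /orP[/eqP<-|r_gt0]; first by
      rewrite subr0 mul1r mul0r addr0.
    by rewrite ltr_wpDl// mulr_gt0.
  have [||w [w0 w1 ew]] := surj (r * s' / ((1 - r) * s + r * s')).
  - by rewrite divr_ge0// ltW.
  - by rewrite ler_pdivrMr// mul1r lerDr.
  exists (seg_pt x y w), ((1 - r) * q + r * q').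
    by rewrite addr_ge0// mulr_ge0.
  exists ((1 - r) * s + r * s') => //.
  rewrite ew !hvec_seg eu ev; apply/rowP => i; rewrite !mxE; field.
  by rewrite gt_eqF.
have coef_o' z p a k : P z p -> a *: hvec p + k *: (- o) = 0 -> a = 0 /\ k = 0.
  move=> Pp h; have [|-> /eqP] := @coef_o z p a (- k) Pp; first by
    rewrite scaleNr -scalerN.
  by rewrite oppr_eq0 => /eqP.
have [z [g g0 [e e0 ez]]] := reach t o Pt tT (surj_t x y ^~ xy) coef_o.
have [z' [g' g'0 [e' e'0 ez']]] := reach b (- o) Pb bT (surj_b x y ^~ xy) coef_o'.
(* Both expressions describe the same point, so [t z] lies in the span of [P z']; as [o] does too,
   so does all of [P z]. *)
have zz' : z = z'.
  apply/eqP; apply: contrapT => /negP zz'; apply: (span_not_sub (allN z')) (_ :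
    z' != z) _.
    by rewrite eq_sym.
  rewrite (line_span (allN z) (Pt z)); apply/span_subvP => w; rewrite !inE =>
    /orP[]/eqP->;
    last exact: oN.
  rewrite -[hvec (t z)](scalerK (lt0r_neq0 e0)) memvZ//.
  have -> : e *: hvec (t z) = e' *: hvec (b z') + (g + g') *: o.
    move: ez; rewrite ez' => /rowP ez; apply/rowP => i; have := ez i; rewrite !mxE; lra.
  by rewrite memvD// memvZ// ?hspan_in// oN.
rewrite -zz' in ez' => {zz' z'}; exists z => //.
have [s [q [s0 q0 et]]] := bT _ _ (Pt z).
have [h1 h2] : e * s - e' = 0 /\ e * q - g - g' = 0.
  apply: (coef_o (Pb z)); move: ez; rewrite ez' et => /rowP ez; apply/rowP => i.
  by have := ez i; rewrite !mxE; lra.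
have [q_0|q_neq0] := eqVneq q 0.
  have g_0 : g = 0 by move: h2; rewrite q_0; lra.
  move: ez; rewrite g_0 scale0r subr0 -[LHS]scale1r.
  by move=> /(scale_hvec_inj (oner_neq0 _))[_ ->].
have q_gt0 : 0 < q by rewrite lt_def q_neq0.
(* Replacing [o] by its expression through top and bottom of [P z] gives these two weights; the
   first equals [g' / q]. *)
have c1 : 0 <= e - g / q.
  have -> : e - g / q = g' / q by have -> : g' = e * q - g; [lra|field].
  by rewrite divr_ge0.
have c2 : 0 <= g / q * s by rewrite mulr_ge0// divr_ge0.
have [m Pm em] := cone2 (@cvx (ccset1 z)) (Pt z) (Pb z) c1 c2.
suff [_ ->] : 1 = e - g / q + g / q * s /\ seg_pt u v r = m by [].
apply: scale_hvec_inj (oner_neq0 _) _; rewrite scale1r -em ez et.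
by apply/rowP => i; rewrite !mxE; field.
Qed.

End Center.

End Disjoint.

Lemma point_images_convex : convex_set (\bigcup_(x : 'rV[R]_c) P x).
Proof.
have [[p Fp]|nF] := pselect (exists p, F p); first exact: cone_convex Fp.
have F0 p : ~ F p by move=> Fp; apply: nF; exists p.
have [[n Nn]|nN] := pselect (exists n, \dim (hspan (P n)) == 2%N); last first.
  by apply: single_convex => // x; apply/negP => Nx; apply: nN; exists x.
have [v v0 vN] := center_ex F0 Nn.
exact (center_convex F0 Nn v0 vN).
Qed.

End Homomorphism.

(** * From the conditions on points to a homomorphism *)

Section Converse.
Context {R : realType} {c d : nat}.
Variable Phi : ccset R c -> ccset R d.
Hypothesis c_gt0 : (0 < c)%N.
Hypothesis point_sub : forall (C : ccset R c) (x : 'rV[R]_c),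
  ccset_val C x -> Phi (ccset1 x) `<=` Phi C.
Hypothesis point_meet : forall (C : ccset R c) (x : 'rV[R]_c),
  ~ ccset_val C x -> Phi (ccset1 x) `&` Phi C = Phi ccset0.
Hypothesis points_convex : convex_set (\bigcup_(x : 'rV[R]_c) Phi (ccset1 x)).
Hypothesis polytope_sub : forall (C : ccset R c) (n : nat) (x : 'I_n -> 'rV[R]_c),
  (0 < n)%N -> C `<=` convex_hull (range x) ->
  Phi C `<=` convex_hull (\bigcup_(i : 'I_n) Phi (ccset1 (x i))).

Let empty_sub (C : ccset R c) : Phi ccset0 `<=` Phi C.
Proof.
have point y : Phi ccset0 `<=` Phi (ccset1 y).
  have [|e] := @exists_notin _ _ (0 : {vspace 'rV[R]_c})%VS.
    by rewrite dimv0 dimvf /dim /= mul1n.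
  rewrite memv0 => e0; rewrite -(@point_meet (ccset1 y) (y + e)) => [p []//|/= ye].
  by move/eqP: e0; apply; apply: (addrI y); rewrite addr0.
have [[y Cy]|nC] := pselect (exists y, ccset_val C y).
  by apply: subset_trans (point y) _; exact: point_sub.
suff -> : C = ccset0 by [].
by apply: ccset_ext; rewrite -subset0 => y Cy; apply: nC; exists y.
Qed.

(** Enclose [C] in a polytope: its image lies in the convex union of point images, so [p] is in the
    image of some [x], and [point_meet] forces [x] into [C]. *)
Let image_cases (C : ccset R c) p : ccset_val (Phi C) p -> ~ ccset_val (Phi ccset0) p ->
  exists2 x, ccset_val C x & ccset_val (Phi (ccset1 x)) p.
Proof.
move=> Cp nFp; have [k [w k0 Cw]] := bounded_sub_hull C c_gt0.
have sub : convex_hull (\bigcup_(i : 'I_k) Phi (ccset1 (w i))) `<=`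
    \bigcup_(x : 'rV[R]_c) Phi (ccset1 x).
  by apply: hull_min => // q [i _ Pq]; exists (w i).
have [x _ Px] := sub _ (polytope_sub k0 Cw Cp).
exists x => //; apply: contrapT => nCx; apply: nFp.
by rewrite -(point_meet nCx); split.
Qed.

Let image_mono (A B : ccset R c) : A `<=` B -> Phi A `<=` Phi B.
Proof.
move=> AB p Ap; have [Fp|nFp] := pselect (ccset_val (Phi ccset0) p).
  exact: empty_sub.
by have [x Ax] := image_cases Ap nFp; apply: point_sub; exact: AB.
Qed.

Lemma lattice_hom_of_points : lattice_hom Phi.
Proof.
split=> C D; apply: ccset_ext.
  rewrite !ccset_meetE; apply/seteqP; split=> p.
    by move=> h; split; apply: image_mono h; rewrite ccset_meetE => x [].
  move=> [Cp Dp]; have [Fp|nFp] := pselect (ccset_val (Phi ccset0) p).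
    exact: empty_sub.
  have [x Cx Px] := image_cases Cp nFp; apply: (@point_sub _ x) => //.
  split => //; apply: contrapT => nDx; apply: nFp.
  by rewrite -(point_meet nDx); split.
rewrite [RHS]ccset_joinE; apply/seteqP; split=> p; last first.
  apply: hull_min; first exact: ccset_convex.
  by rewrite subUset; split; apply: image_mono; [exact: joinl|exact: joinr].
move=> CDp; have [Fp|nFp] := pselect (ccset_val (Phi ccset0) p).
  by apply: sub_hull; left; exact: empty_sub.
have [x CDx Px] := image_cases CDp nFp.
have [[u Cu]|nC] := pselect (exists u, ccset_val C u); last first.
  apply: sub_hull; right; apply: point_sub Px; apply: join_min CDx => //.
  by move=> u Cu; exfalso; apply: nC; exists u.
have [[v Dv]|nD] := pselect (exists v, ccset_val D v); last first.
  apply: sub_hull; left; apply: point_sub Px; apply: join_min CDx => //.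
  by move=> v Dv; exfalso; apply: nD; exists v.
have [u' [v' [s [Cu' Dv' /andP[s0 s1] xE]]]] := join_inv Cu Dv CDx.
(* The polytope condition is used for the segment from a point of [C] to a point of [D] that
   contains [x]. *)
pose w (i : 'I_2) := if i == ord0 then u' else v'.
have xw : ccset1 x `<=` convex_hull (range w).
  move=> _ ->; rewrite xE; apply: convex_seg => //; first exact: convex_set_hull.
    by apply: sub_hull; exists ord0.
  by apply: sub_hull; exists ord_max.
apply: hull_min (polytope_sub _ xw Px) => //; first exact: convex_set_hull.
move=> q [i _]; rewrite /w; case: ifP => _ Pq; apply: sub_hull.
  by left; exact: point_sub Pq.
by right; exact: point_sub Pq.
Qed.

End Converse.

Theorem corollary4p5 (R : realType) (c : nat) (hc : (3 <= c)%N)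
    (Phi : ccset R c -> ccset R c.+1) :
  (lattice_hom Phi /\ ~ trivial_map Phi)
  <->
  ((exists C D : ccset R c, Phi C <> Phi D) /\
   (forall (C : ccset R c) (x : 'rV[R]_c),
      ccset_val C x -> Phi (ccset1 x) `<=` Phi C) /\
   (forall (C : ccset R c) (x : 'rV[R]_c),
      ~ ccset_val C x -> Phi (ccset1 x) `&` Phi C = Phi ccset0) /\
   convex_set (\bigcup_(x : 'rV[R]_c) Phi (ccset1 x)) /\
   (forall (C : ccset R c) (n : nat) (x : 'I_n -> 'rV[R]_c), (0 < n)%N ->
      C `<=` convex_hull (range x) ->
      Phi C `<=` convex_hull (\bigcup_(i : 'I_n) Phi (ccset1 (x i))))).
Proof.
have c_gt0 : (0 < c)%N by apply: leq_trans hc.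
split=> [[[PhiI PhiU] nontrivial]|[[C [D CD]] [h1 [h2 [h3 h4]]]]]; last first.
  split; first exact: lattice_hom_of_points.
  by move=> [E ECD]; apply: CD; rewrite !ECD.
split.
  apply: contrapT => h; apply: nontrivial; exists (Phi ccset0) => C.
  by apply: contrapT => nC; apply: h; exists C, ccset0.
split; first by move=> C x Cx; apply: hom_mono => // _ ->.
split.
  move=> C x nCx; apply/seteqP; split.
    by apply: hom_meet => // _ [-> /nCx].
  by rewrite subsetI; split; apply: hom_mono.
split; first exact: point_images_convex.
move=> C n x n0 Cx; apply: hom_polytope Cx => //; first exact: convex_set_hull.
  (* [Phi ccset0] enters the hull through the image of one generator, which exists by [0 < n]. *)
  apply: subset_trans (_ : Phi (ccset1 (x (Ordinal n0))) `<=` _); first exact: hom_mono.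
  by move=> p Pp; apply: sub_hull; exists (Ordinal n0).
by move=> i p Pp; apply: sub_hull; exists i.
Qed.
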